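(* Let $X$ be a Banach space over $\mathbb{K}$ ($\mathbb{K}=\mathbb{R}$ or $\mathbb{C}$) and let $T : X \to X$ be an invertible generalized hyperbolic operator. Then $T$ is time-dependent stable; that is, there exists $\varepsilon > 0$ such that $$(T+L_1) \circ \cdots \circ (T+L_p) \ \text{ is topologically conjugate to } \ T^p$$ whenever $p \in \mathbb{N}$ and $L_1,\ldots,L_p$ are Lipschitz maps from $X$ into itself with $\|L_j\|_\infty < \varepsilon$ and $\operatorname{Lip}(L_j) < \varepsilon$ for all $j \in \{1,\ldots,p\}$.
   Context: $\mathbb{N}$ denotes the set of positive integers. An operator on a Banach space $X$ is a continuous linear map $X \to X$; $T$ invertible means it is bijective with continuous inverse. $\sigma(\cdot)$ denotes the spectrum (for real Banach spaces, understood as the spectrum of the complexification), and $\mathbb{D}$ is the open unit disc in $\mathbb{C}$. For a map $F : X \to X$ (not necessarily linear), $\|F\|_\infty = \sup_{x \in X}\|F(x)\|$ and $\operatorname{Lip}(F) = \sup_{x \neq x'} \frac{\|F(x)-F(x')\|}{\|x-x'\|}$; $F$ is Lipschitz if $\operatorname{Lip}(F) < \infty$. An invertible operator $T$ on $X$ is generalized hyperbolic if there is a direct sum decomposition $X = M \oplus N$, where $M$ and $N$ are closed subspaces of $X$ such that (GH1) $T(M) \subset M$ and $\sigma(T|_M) \subset \mathbb{D}$, (GH2) $T^{-1}(N) \subset N$ and $\sigma(T^{-1}|_N) \subset \mathbb{D}$. A map $g : X \to X$ is topologically conjugate to a map $f : X \to X$ if there is a homeomorphism $h : X \to X$ with $g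 = h \circ f \circ h^{-1}$. *)

(* Defs.v *)
From HB Require Import structures.
From mathcomp Require Import all_boot all_order all_algebra.
From mathcomp Require Import all_classical all_reals all_analysis.
From mathcomp Require Export complex.
Set Implicit Arguments.
Unset Strict Implicit.
Unset Printing Implicit Defensive.
Import Order.TTheory GRing.Theory Num.Theory numFieldNormedType.Exports.
Local Open Scope classical_set_scope.
Local Open Scope ring_scope.
Local Open Scope complex_scope.

(* The choice between K = R and K = C. *)
Variant scalar_kind := RealScalars | ComplexScalars.

Definition scalar_field (R : realType) (k : scalar_kind) : numFieldType :=
  match k with
  | RealScalars => R
  | ComplexScalars => R[i]
  end.

(* Norms of a normedModType over K live in K; when K = R[i] they are the complex
   numbers c%:C with c >= 0 real, so taking real parts loses nothing. *)
Definition real_part (R : realType) (k : scalar_kind) : scalar_field R k -> R :=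
  match k with
  | RealScalars => fun x => x
  | ComplexScalars => fun z => complex.Re z
  end.

Definition rnorm (R : realType) (k : scalar_kind)
  (X : normedModType (scalar_field R k)) (x : X) : R := real_part `|x|.

(* X (+) iX, with (x, y) standing for x + iy. The topology is that of the
   product, which is the one induced by each of the usual equivalent norms of the
   complexification. *)
Definition complexification (R : realType) (X : normedModType R) : Type :=
  (X * X)%type.

Section ComplexificationLmodule.
Context (R : realType) (X : normedModType R).
Local Notation XC := (complexification X).

HB.instance Definition _ := GRing.Zmodule.copy XC (X * X)%type.
HB.instance Definition _ := Topological.copy XC (X * X)%type.

Definition complexification_scale (c : R[i]) (z : XC) : XC :=
  (complex.Re c *: z.1 - complex.Im c *: z.2,
   complex.Re c *: z.2 + complex.Im c *: z.1).

Fact complexification_scaleA (a b : R[i]) (z : XC) :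
  complexification_scale a (complexification_scale b z) =
  complexification_scale (a * b) z.
Proof.
case: a b z => [a1 a2] [b1 b2] [x y]; rewrite /complexification_scale /=.
rewrite !(scalerBr, scalerDr, scalerBl, scalerDl) !scalerA.
congr pair; last by rewrite [X in _ + X]addrC addrACA.
by rewrite !opprD [X in _ + X]addrC addrACA.
Qed.

Fact complexification_scale1 : left_id 1 complexification_scale.
Proof.
by case=> x y; rewrite /complexification_scale /= !scale1r !scale0r subr0 addr0.
Qed.

Fact complexification_scaleDr : right_distributive complexification_scale +%R.
Proof.
case=> a b [x y] [x' y']; rewrite /complexification_scale /=.
by congr pair; rewrite /= !scalerDr ?opprD addrACA.
Qed.

Fact complexification_scaleDl (z : XC) :
  {morph complexification_scale^~ z : a b / a + b}.
Proof.
case: z => x y [a b] [a' b']; rewrite /complexification_scale /=.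
by congr pair; rewrite /= !scalerDl ?opprD addrACA.
Qed.

HB.instance Definition _ := GRing.Zmodule_isLmodule.Build R[i] XC
  complexification_scaleA complexification_scale1
  complexification_scaleDr complexification_scaleDl.
End ComplexificationLmodule.

(* f restricts to an invertible operator on the subspace M. *)
Definition invertible_on (V : topologicalType) (M : set V) (f : V -> V) : Prop :=
  set_bij M M f /\
  exists g : V -> V,
    [/\ {within M, continuous g}, forall x, M x -> M (g x)
      & forall x, M x -> g (f x) = x /\ f (g x) = x].

(* Spectrum of the restriction to M of an operator f with f(M) included in M. *)
Definition spectrum_on (R : realType) (V : preTopologicalLmodType R[i])
    (M : set V) (f : V -> V) : set R[i] :=
  [set l | ~ invertible_on M (fun x => l *: x - f x)].

(* For K = R, the complexification of the restriction of f to M is the restriction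
   to M + iM of the complexification of f. *)
Definition spectrum_restr (R : realType) (k : scalar_kind) :
    forall X : normedModType (scalar_field R k), set X -> (X -> X) -> set R[i] :=
  match k with
  | RealScalars => fun X M f =>
      @spectrum_on R (complexification X) (M `*` M) (fun z => (f z.1, f z.2))
  | ComplexScalars => fun X M f => @spectrum_on R X M f
  end.

Definition open_unit_disc (R : realType) : set R[i] := [set z | `|z| < 1].

Definition closed_subspace (K : numFieldType) (X : normedModType K) (M : set X) :
    Prop :=
  closed M /\ submod_closed [pred x | x \in M].

Definition direct_sum (K : numFieldType) (X : normedModType K) (M N : set X) :
    Prop :=
  (forall x, exists m n, [/\ M m, N n & x = m + n]) /\ M `&` N = [set 0].

(* S is the continuous inverse of the continuous bijection T. *)
Definition homeo_inverse (U V : topologicalType) (T : U -> V) (S : V -> U) : Prop :=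
  [/\ continuous T, continuous S, cancel T S & cancel S T].

(* S is T^-1; it is determined by T. *)
Definition generalized_hyperbolic (R : realType) (k : scalar_kind)
    (X : normedModType (scalar_field R k)) (T : {linear X -> X}) : Prop :=
  exists S : X -> X, homeo_inverse T S /\
  exists M N : set X,
    [/\ closed_subspace M, closed_subspace N, direct_sum M N,
      T @` M `<=` M /\ spectrum_restr M T `<=` @open_unit_disc R
      & S @` N `<=` N /\ spectrum_restr N S `<=` @open_unit_disc R].

Definition sup_norm (R : realType) (k : scalar_kind)
    (X : normedModType (scalar_field R k)) (F : X -> X) : \bar R :=
  ereal_sup [set (rnorm (F x))%:E | x in [set: X]].

(* When X = 0 this is -oo rather than 0, which is harmless: it is only compared
   with +oo and with positive reals. *)
Definition Lip (R : realType) (k : scalar_kind)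
    (X : normedModType (scalar_field R k)) (F : X -> X) : \bar R :=
  ereal_sup [set (rnorm (F p.1 - F p.2) / rnorm (p.1 - p.2))%:E
            | p in [set p : X * X | p.1 != p.2]].

Definition Lipschitz (R : realType) (k : scalar_kind)
    (X : normedModType (scalar_field R k)) (F : X -> X) : Prop :=
  (Lip F < +oo)%E.

Definition topologically_conjugate (X : topologicalType) (g f : X -> X) : Prop :=
  exists h h' : X -> X, homeo_inverse h h' /\ g = h \o f \o h'.

(* The big operator composes from the left: its value is
   (T + L 0) \o (T + L 1) \o ... \o (T + L (p - 1)). *)
Definition time_dependent_stable (R : realType) (k : scalar_kind)
    (X : normedModType (scalar_field R k)) (T : {linear X -> X}) : Prop :=
  exists2 eps : R, 0 < eps &
    forall (p : nat) (L : 'I_p -> X -> X), (0 < p)%N ->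
      (forall j, [/\ Lipschitz (L j), (sup_norm (L j) < eps%:E)%E
                   & (Lip (L j) < eps%:E)%E]) ->
      topologically_conjugate
        (\big[comp/id]_(j < p) (fun x => T x + L j x)) (iter p T).

(* Main.v *)
(* Write f_i = T + L_i and look for maps h_i = id + u_i, u_i bounded, with
   h o f_i = T o h along the cyclic sequence of the f_i. The equation for u is
   linear; it is not uniquely solvable, but summing its P-part along the past and
   its Q-part along the future (P, Q the projections of X = M + N) turns it into a
   fixed point equation for a contraction, whose bounded solution is unique.
   The same recipe gives k_i = id + w_i with k o T = f_i o k, and uniqueness of
   the bounded fixed points shows that h and k are inverse to each other.

   The contraction property needs |T^n| <= 1/2 on M for some n. With A = T|M and
   R(z) = (1 - z A)^-1, bounded and Lipschitz on the closed disc by compactness,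
   the identity (1 - z^2 B^2)^-1 = ((1 - z B)^-1 + (1 + z B)^-1) / 2 carries both
   bounds over to the resolvents of B = A^(2^k), uniformly in k. Hence if
   t^n A^n -> 0 along n = 2^k, then |s^n A^n| <= 1/3 for large k whenever s is
   within a fixed distance of t, and finitely many steps lead from t = 0 to s = 1. *)
From HB Require Import structures.
Require Import Defs.
From mathcomp Require Import all_boot all_order all_algebra.
From mathcomp Require Import all_classical all_reals all_analysis.
From mathcomp Require Import ring lra.
Set Implicit Arguments.
Unset Strict Implicit.
Unset Printing Implicit Defensive.
Import Order.TTheory GRing.Theory Num.Theory numFieldNormedType.Exports.
Local Open Scope classical_set_scope.
Local Open Scope ring_scope.

(** * Geometric sequences, completeness and changes of norm *)

Section RealPowers.
Context (R : realType).

Lemma geometric_small (C q e : R) : 0 <= q < 1 -> 0 < e ->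
  exists n0, forall n, (n0 <= n)%N -> C * q ^+ n < e.
Proof.
move=> /andP[q0 q1] e0.
have Q1 : `|q| < 1 by rewrite ger0_norm.
have := cvg_geometric C Q1.
move=> /cvgrPdist_lt/(_ _ e0)[n0 _ H]; exists n0 => n /H /=.
by rewrite /geometric /= sub0r normrN; apply: le_lt_trans; rewrite ler_norm.
Qed.

Lemma geometric_dominated0 (x C q : R) : 0 <= q < 1 ->
  (forall n, x <= C * q ^+ n) -> x <= 0.
Proof.
move=> q01 H; rewrite leNgt; apply/negP => x0.
have [n0 Hn] := geometric_small C q01 x0.
by have := lt_le_trans (Hn _ (leqnn _)) (H n0); rewrite ltxx.
Qed.

End RealPowers.

Section MetricNotions.
Context (R : realType).

(** Phrased by epsilon and delta on a normed group, so that continuity can be tested for a new norm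
    whatever topology the space carries. *)
Definition metric_continuous (V W : normedZmodType R) (f : V -> W) :=
  forall x e, 0 < e ->
    exists2 d : R, 0 < d & forall y, `|x - y| < d -> `|f x - f y| < e.

(* Completeness, tested only on sequences with geometrically decreasing steps. *)
Definition geometrically_complete (V : normedZmodType R) :=
  forall (u : nat -> V) (C q : R), 0 <= q < 1 ->
    (forall n, `|u n.+1 - u n| <= C * q ^+ n) ->
    exists l, forall n, `|l - u n| <= C * q ^+ n / (1 - q).

Lemma metric_continuousD (V W : normedZmodType R) (f g : V -> W) :
  metric_continuous f -> metric_continuous g ->
  metric_continuous (fun x => f x + g x).
Proof.
move=> cf cg x e e0; have e20 : 0 < e / 2 by rewrite divr_gt0.
have [d d0 Hd] := cf x _ e20; have [d' d'0 Hd'] := cg x _ e20.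
exists (Num.min d d'); first by rewrite lt_min d0.
move=> y; rewrite lt_min => /andP[/Hd H1 /Hd' H2].
rewrite opprD addrACA (splitr e).
by apply: le_lt_trans (ler_normD _ _) _; exact: ltrD.
Qed.

Lemma metric_continuous_comp (U V W : normedZmodType R) (f : V -> W)
    (g : U -> V) :
  metric_continuous f -> metric_continuous g -> metric_continuous (f \o g).
Proof.
move=> cf cg x e e0; have [d d0 Hd] := cf (g x) _ e0.
have [d' d'0 Hd'] := cg x _ d0; exists d' => // y /Hd'; exact: Hd.
Qed.

Lemma metric_continuous_id (V : normedZmodType R) :
  metric_continuous (fun x : V => x).
Proof. by move=> x e e0; exists e. Qed.

Lemma metric_continuous_lipschitz (V W : normedZmodType R) (C : R) (f : V -> W) :
  (forall x y, `|f x - f y| <= C * `|x - y|) -> metric_continuous f.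
Proof.
move=> Hf x e e0; have C0 : 0 < `|C| + 1 by rewrite ltr_wpDl.
exists (e / (`|C| + 1)); first by rewrite divr_gt0.
move=> y; rewrite ltr_pdivlMr // => Hy; apply: le_lt_trans (Hf x y) _.
apply: le_lt_trans Hy; rewrite mulrC ler_wpM2l //.
by rewrite (le_trans (ler_norm _)) // lerDl.
Qed.

Lemma metric_continuousN (V W : normedZmodType R) (f : V -> W) :
  metric_continuous f -> metric_continuous (fun x => - f x).
Proof.
move=> cf; apply: (metric_continuous_comp _ cf).
by apply: (@metric_continuous_lipschitz _ _ 1) => x y; rewrite mul1r -opprD normrN.
Qed.

Lemma metric_continuous_additive (V W : normedZmodType R) (C : R)
    (f : {additive V -> W}) :
  (forall x, `|f x| <= C * `|x|) -> metric_continuous f.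
Proof.
by move=> Hf; apply: (@metric_continuous_lipschitz _ _ C) => x y; rewrite -raddfB.
Qed.

End MetricNotions.

Lemma geometric_tail (R : realType) (V : normedZmodType R) (u : nat -> V)
    (C q : R) : 0 <= q < 1 -> (forall n, `|u n.+1 - u n| <= C * q ^+ n) ->
  forall n j, `|u (n + j)%N - u n| <= C * q ^+ n / (1 - q).
Proof.
move=> /andP[q0 q1] uq n j; have q1' : 0 < 1 - q by rewrite subr_gt0.
have C0 : 0 <= C by have := uq 0%N; rewrite expr0 mulr1; apply: le_trans.
(* The exact partial sum of the geometric series is the bound that passes through the induction on
   [j]. *)
apply: le_trans (_ : C * q ^+ n * (1 - q ^+ j) / (1 - q) <= _); last first.
  rewrite ler_wpM2r ?invr_ge0 ?(ltW q1') // ler_piMr ?mulr_ge0 ?exprn_ge0 //.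
  by rewrite lerBlDr lerDl exprn_ge0.
elim: j => [|j IH]; first by rewrite addn0 subrr normr0 expr0 subrr mulr0 mul0r.
rewrite addnS -[u _.+1](subrK (u (n + j)%N)) -addrA.
apply: le_trans (ler_normD _ _) _; apply: le_trans (lerD (uq _) IH) _.
rewrite le_eqVlt; apply/orP; left; apply/eqP; rewrite exprD exprS.
by field; rewrite gt_eqF.
Qed.

(** An equivalent norm spoils the constant, hence the free [C']. The sharp constant comes back by
    comparing [u n] with a term so late that the [C']-bound there is below [e]. *)
Lemma geometrically_complete_of_limit (R : realType) (V : normedZmodType R) :
  (forall (u : nat -> V) (C q : R), 0 <= q < 1 ->
    (forall n, `|u n.+1 - u n| <= C * q ^+ n) ->
    exists l C', forall n, `|l - u n| <= C' * q ^+ n) ->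
  geometrically_complete V.
Proof.
move=> H u C q q01 uq; have [l [C' ul]] := H u C q q01 uq.
exists l => n; apply/ler_addgt0Pr => e e0.
have [m Hm] := geometric_small C' q01 e0.
have H1 := le_lt_trans (ul (n + m)%N) (Hm _ (leq_addl _ _)).
rewrite -[l](subrK (u (n + m)%N)) -addrA; apply: le_trans (ler_normD _ _) _.
by rewrite [leLHS]addrC; apply: lerD (geometric_tail q01 uq n m) (ltW H1).
Qed.

Section Renorming.
Context (R : realType) (X : zmodType).

Record group_norm (mu : X -> R) : Prop := GroupNorm {
  group_normD : forall x y, mu (x + y) <= mu x + mu y;
  group_norm_eq0 : forall x, mu x = 0 -> x = 0;
  group_normMn : forall x n, mu (x *+ n) = mu x *+ n;
  group_normN : forall x, mu (- x) = mu x }.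

(** A copy of [X] indexed by the proof, so that [mu] does not collide with a norm that [X] already
    has. Only the group structure is normed, which treats real and complex scalars alike. *)
Definition renormed (mu : X -> R) (_ : group_norm mu) : Type := X.

Context (mu : X -> R) (gmu : group_norm mu).

HB.instance Definition _ := GRing.Zmodule.copy (renormed gmu) X.
HB.instance Definition _ := Num.Zmodule_isNormed.Build R (renormed gmu)
  (group_normD gmu) (group_norm_eq0 gmu) (group_normMn gmu) (group_normN gmu).

Lemma renormedE (x : renormed gmu) : `|x| = mu x.
Proof. by []. Qed.

End Renorming.

(** * Bounded fixed points of sup-norm contractions *)

Section BoundedFixpoint.
Context (R : realType) (V : normedZmodType R) (I : Type).
Implicit Types (u w : I -> V -> V) (Phi : (I -> V -> V) -> I -> V -> V).

Definition sup_bounded u := exists b : R, forall i x, `|u i x| <= b.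

(** An arbitrary bound [c] replaces the sup distance, so no supremum has to be formed. *)
Definition sup_contraction (q : R) Phi := forall u w (c : R),
  (forall i x, `|u i x - w i x| <= c) ->
  forall i x, `|Phi u i x - Phi w i x| <= q * c.

Lemma bounded_fixpoint_unique q Phi u w : 0 <= q < 1 -> sup_contraction q Phi ->
  sup_bounded u -> sup_bounded w ->
  (forall i x, u i x = Phi u i x) -> (forall i x, w i x = Phi w i x) ->
  forall i x, u i x = w i x.
Proof.
move=> q01 cPhi [b ub] [b' wb'] uE wE i x.
have H n j y : `|u j y - w j y| <= (b + b') * q ^+ n.
  elim: n j y => [|n IH] j y; last by rewrite uE wE exprS mulrCA; exact: cPhi.
  rewrite expr0 mulr1; apply: le_trans (ler_normB _ _) _; exact: lerD.
by apply/eqP; rewrite -subr_eq0 -normr_le0; apply: geometric_dominated0 q01 _.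
Qed.

(** Picard iteration from 0. The n-th iterate is within [D n] of its pointwise limit, uniformly in
    [i] and [x], so boundedness and continuity pass to the limit. *)
Lemma bounded_fixpoint_exists q Phi : geometrically_complete V ->
  0 <= q < 1 -> sup_contraction q Phi -> sup_bounded (Phi (fun _ _ => 0)) ->
  (forall u, (forall i, metric_continuous (u i)) ->
     forall i, metric_continuous (Phi u i)) ->
  exists u, [/\ sup_bounded u, (forall i, metric_continuous (u i))
    & forall i x, u i x = Phi u i x].
Proof.
move=> cV q01 cPhi [b Hb] contPhi; have /andP[q0 q1] := q01.
pose un n := iter n Phi (fun _ _ => 0).
have cun n i : metric_continuous (un n i).
  elim: n i => [|n IH] i; last exact: contPhi.
  by move=> x e e0; exists 1 => // y _; rewrite subrr normr0.
have step n i x : `|un n.+1 i x - un n i x| <= b * q ^+ n.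
  elim: n i x => [|n IH] i x; first by rewrite expr0 mulr1 /= subr0; exact: Hb.
  by rewrite exprS mulrCA; exact: cPhi.
pose D n := b * q ^+ n / (1 - q).
have /choice[u uP] : forall ix : I * V, exists l,
    forall n, `|l - un n ix.1 ix.2| <= D n.
  by case=> i x; apply: cV.
have uD n i x : `|u (i, x) - un n i x| <= D n by exact: (uP (i, x)).
have Dsmall e : 0 < e -> exists n, D n < e.
  move=> e0; have q1' : 0 < 1 - q by rewrite subr_gt0.
  have [n0 Hn] := geometric_small b q01 (mulr_gt0 e0 q1').
  by exists n0; rewrite /D ltr_pdivrMr //; exact: Hn.
exists (fun i x => u (i, x)); split.
- by exists (D 0%N) => i x; have := uD 0%N i x; rewrite subr0.
- move=> i x e e0; have e30 : 0 < e / 3 by rewrite divr_gt0.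
  have [n Dn] := Dsmall _ e30; have [d d0 Hd] := cun n i x _ e30.
  exists d => // y /Hd Hy.
  have -> : u (i, x) - u (i, y) = (u (i, x) - un n i x) +
      (un n i x - un n i y) + (un n i y - u (i, y)).
    by rewrite !addrA subrK subrK.
  apply: le_lt_trans (ler_normD _ _) _.
  apply: le_lt_trans (lerD (ler_normD _ _) (lexx _)) _.
  have := uD n i x; have := uD n i y; rewrite distrC => H1 H2; lra.
(* Passing through [un n.+1 = Phi (un n)] bounds the defect by [D n.+1 + q * D n], for every [n]. *)
- move=> i x; apply/eqP; rewrite -subr_eq0 -normr_le0.
  apply: (@geometric_dominated0 _ _ (2 * b / (1 - q)) q q01) => n.
  have -> : u (i, x) - Phi (fun i x => u (i, x)) i x = (u (i, x) - un n.+1 i x) +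
      (Phi (un n) i x - Phi (fun i x => u (i, x)) i x) by rewrite addrA subrK.
  apply: le_trans (ler_normD _ _) _.
  have H1 := uD n.+1 i x; have H2 : forall i x, `|un n i x - u (i, x)| <= D n.
    by move=> j y; rewrite distrC; exact: uD.
  have H3 := cPhi _ _ _ H2 i x; apply: le_trans (lerD H1 H3) _.
  have -> : D n.+1 = q * D n by rewrite /D exprS; ring.
  have -> : 2 * b / (1 - q) * q ^+ n = D n + D n by rewrite /D; ring.
  have Dn0 : 0 <= D n by apply: le_trans (uD n i x).
  by apply: lerD; rewrite ler_piMl // ltW.
Qed.

End BoundedFixpoint.

(** * Conjugacy for a norm adapted to the splitting *)

Section AdaptedSplitting.
Context (R : realType) (V : normedZmodType R) (T S P Q : {additive V -> V})
  (lam a b : R).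

(* The norm is adapted to the splitting: T contracts the range of P and
   S = T^-1 contracts the range of Q, both by the factor lam. *)
Record adapted_splitting : Prop := AdaptedSplitting {
  split_TK : cancel T S;
  split_SK : cancel S T;
  split_PQ : forall x, P x + Q x = x;
  split_PP : forall x, P (P x) = P x;
  split_PTP : forall x, P (T (P x)) = T (P x);
  split_PSQ : forall x, P (S (Q x)) = 0;
  split_lam : 0 <= lam < 1;
  split_P : forall x, `|P x| <= `|x|;
  split_TP : forall x, `|T (P x)| <= lam * `|x|;
  split_SQ : forall x, `|S (Q x)| <= lam * `|x|;
  split_max : forall x c, `|P x| <= c -> `|Q x| <= c -> `|x| <= c;
  split_T : forall x, `|T x| <= a * `|x|;
  split_S : forall x, `|S x| <= b * `|x| }.

Hypothesis spl : adapted_splitting.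
Hypothesis complV : geometrically_complete V.
Context (I : Type) (s s' : I -> I).
Hypotheses (sK : cancel s s') (s'K : cancel s' s).
Implicit Types (F G L u w h : I -> V -> V) (v : I -> V -> V -> V).

Let Q_P x : Q (P x) = 0.
Proof. by have := split_PQ spl (P x); rewrite (split_PP spl) -[RHS]addr0 => /addrI. Qed.

Let P_Q x : P (Q x) = 0.
Proof.
have : P (P x + Q x) = P x by rewrite (split_PQ spl).
by rewrite raddfD (split_PP spl) -[RHS]addr0 => /addrI.
Qed.

Let Q_TP x : Q (T (P x)) = 0.
Proof. by rewrite -(split_PTP spl) Q_P. Qed.

Let Q_SQ x : Q (S (Q x)) = S (Q x).
Proof. by have := split_PQ spl (S (Q x)); rewrite (split_PSQ spl) add0r. Qed.

Let contP : metric_continuous P.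
Proof. by apply: (@metric_continuous_additive _ _ _ 1) => x; rewrite mul1r split_P. Qed.

Let contTP : metric_continuous (T \o P).
Proof. by apply: (@metric_continuous_additive _ _ _ lam) => x; exact: split_TP. Qed.

Let contSQ : metric_continuous (S \o Q).
Proof. by apply: (@metric_continuous_additive _ _ _ lam) => x; exact: split_SQ. Qed.

Let contT : metric_continuous T.
Proof. exact: metric_continuous_additive (split_T spl). Qed.

Let contS : metric_continuous S.
Proof. exact: metric_continuous_additive (split_S spl). Qed.

(* The fixed points of [duhamel F G v] solve
   [u (s i) (F i x) = T (u i x) + v i x (u i x)]: the P-component is summed
   along the past of the skew product (i, x) |-> (s i, F i x), the
   Q-component along its future. *)
Definition duhamel F G v u i x :=
  T (P (u (s' i) (G i x))) + P (v (s' i) (G i x) (u (s' i) (G i x)))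
  + (S (Q (u (s i) (F i x))) - S (Q (v i x (u i x)))).

(** The P-part of the fixed point equation at [(s i, F i x)], where [GF] leads back to [(i, x)], and
    [T] applied to its Q-part at [(i, x)] are the two halves of the claim. *)
Lemma duhamel_solution F G v u : (forall i x, G (s i) (F i x) = x) ->
  (forall i x, u i x = duhamel F G v u i x) ->
  forall i x, u (s i) (F i x) = T (u i x) + v i x (u i x).
Proof.
move=> GF uE i x.
have Pu : P (u (s i) (F i x)) = T (P (u i x)) + P (v i x (u i x)).
  rewrite {1}uE /duhamel sK GF !raddfD /= !raddfN /=.
  by rewrite (split_PTP spl) !(split_PSQ spl) oppr0 !addr0 (split_PP spl).
have Qu : Q (u i x) = S (Q (u (s i) (F i x))) - S (Q (v i x (u i x))).
  by rewrite {1}uE /duhamel !raddfD /= !raddfN /= Q_TP Q_P !add0r !Q_SQ.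
have QT : T (Q (u i x)) = Q (u (s i) (F i x)) - Q (v i x (u i x)).
  by rewrite Qu raddfB /= !(split_SK spl).
have Tu : T (u i x) = T (P (u i x)) + T (Q (u i x)) by rewrite -raddfD (split_PQ spl).
rewrite -[LHS](split_PQ spl) Pu Tu QT -[X in _ = _ + X](split_PQ spl).
by rewrite [RHS]addrACA subrK.
Qed.

(** The difference of two values splits into [p] in the range of [P] and [q] in the range of [Q]. By
    [split_max] the two are not added, and each is at most [lam * c + l * c]. *)
Lemma duhamel_contraction F G v (l : R) : 0 <= l ->
  (forall i x y z, `|v i x y - v i x z| <= l * `|y - z|) ->
  sup_contraction (lam + l) (duhamel F G v).
Proof.
move=> l0 vl u w c uw i x; have /andP[lam0 lam1] := split_lam spl.
have c0 : 0 <= c by apply: le_trans (uw i x).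
have vc j y : `|v j y (u j y) - v j y (w j y)| <= l * c.
  by apply: le_trans (vl _ _ _ _) _; rewrite ler_wpM2l.
pose p := T (P (u (s' i) (G i x) - w (s' i) (G i x)))
  + P (v (s' i) (G i x) (u (s' i) (G i x)) - v (s' i) (G i x) (w (s' i) (G i x))).
pose q := S (Q (u (s i) (F i x) - w (s i) (F i x)))
  - S (Q (v i x (u i x) - v i x (w i x))).
have -> : duhamel F G v u i x - duhamel F G v w i x = p + q.
  rewrite /duhamel /p /q !raddfB /= opprD addrACA; congr (_ + _).
    by rewrite opprD addrACA.
  by rewrite !opprD !opprK addrACA.
have Pp : P p = p by rewrite /p raddfD /= (split_PTP spl) (split_PP spl).
have Qp : Q p = 0 by rewrite -Pp Q_P.
have Qq : Q q = q by rewrite /q raddfB /= !Q_SQ.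
have Pq : P q = 0 by rewrite -Qq P_Q.
apply: (split_max spl); rewrite raddfD /=.
  rewrite Pp Pq addr0 mulrDl; apply: le_trans (ler_normD _ _) _; apply: lerD.
    by apply: le_trans (split_TP spl _) _; rewrite ler_wpM2l.
  by apply: le_trans (split_P spl _) _; exact: vc.
rewrite Qp Qq add0r mulrDl; apply: le_trans (ler_normB _ _) _; apply: lerD.
  by apply: le_trans (split_SQ spl _) _; rewrite ler_wpM2l.
apply: le_trans (split_SQ spl _) _; apply: le_trans (vc i x).
by rewrite ler_piMl // ltW.
Qed.

Lemma duhamel_exists F G v (l B : R) : 0 <= l -> lam + l < 1 ->
  (forall i x y z, `|v i x y - v i x z| <= l * `|y - z|) ->
  (forall i x, `|v i x 0| <= B) ->
  (forall i, metric_continuous (F i)) -> (forall i, metric_continuous (G i)) ->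
  (forall u, (forall i, metric_continuous (u i)) ->
    forall i, metric_continuous (fun x => v i x (u i x))) ->
  exists u, [/\ sup_bounded u, (forall i, metric_continuous (u i))
    & forall i x, u i x = duhamel F G v u i x].
Proof.
move=> l0 lam1 vl vB cF cG cv; have /andP[lam0 _] := split_lam spl.
apply: (bounded_fixpoint_exists (q := lam + l)) => //.
- by rewrite addr_ge0.
- exact: duhamel_contraction.
- exists (B + lam * B) => i x; rewrite /duhamel !raddf0 !add0r.
  apply: le_trans (ler_normB _ _) _; apply: lerD.
    exact: le_trans (split_P spl _) _.
  by apply: le_trans (split_SQ spl _) _; rewrite ler_wpM2l.
- move=> u cu i; apply: metric_continuousD; apply: metric_continuousD.
  + apply: (metric_continuous_comp contTP); exact: metric_continuous_comp (cG i).
  + apply: (metric_continuous_comp contP).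
    exact: (metric_continuous_comp (cv u cu (s' i)) (cG i)).
  + apply: (metric_continuous_comp contSQ); exact: metric_continuous_comp (cF i).
  + apply: metric_continuousN; apply: (metric_continuous_comp contSQ); exact: cv.
Qed.

Lemma duhamel_unique F G v (l : R) u w : 0 <= l -> lam + l < 1 ->
  (forall i x y z, `|v i x y - v i x z| <= l * `|y - z|) ->
  sup_bounded u -> sup_bounded w ->
  (forall i x, u i x = duhamel F G v u i x) ->
  (forall i x, w i x = duhamel F G v w i x) ->
  forall i x, u i x = w i x.
Proof.
move=> l0 lam1 vl; have /andP[lam0 _] := split_lam spl.
apply: (bounded_fixpoint_unique (q := lam + l)); last exact: duhamel_contraction.
by rewrite addr_ge0.
Qed.

(** The inverse is sought as [S + g i], which makes [g] a fixed point of a contraction of factor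
    [b * l]. The same factor gives injectivity: [y - x = S (L i x - L i y)] for [y] the inverse
    image of [T x + L i x]. *)
Lemma perturbation_inverse L (l B : R) : 0 <= l -> b * l < 1 -> 0 <= b ->
  (forall i x y, `|L i x - L i y| <= l * `|x - y|) ->
  (forall i x, `|L i x| <= B) ->
  exists G, [/\ forall i, metric_continuous (G i),
    (forall i x, G i (T x + L i x) = x) & forall i y, T (G i y) + L i (G i y) = y].
Proof.
move=> l0 bl b0 Ll LB.
pose Phi (g : I -> V -> V) i y := - S (L i (S y + g i y)).
have [g [_ cg gE]] : exists g, [/\ sup_bounded g,
    (forall i, metric_continuous (g i)) & forall i y, g i y = Phi g i y].
  apply: (bounded_fixpoint_exists (q := b * l)) => //.
  - by rewrite mulr_ge0.
  - move=> u w c uw i x; rewrite /Phi opprK addrC -raddfB.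
    apply: le_trans (split_S spl _) _; rewrite -mulrA ler_wpM2l //.
    apply: le_trans (Ll _ _ _) _; rewrite ler_wpM2l //.
    by rewrite opprD addrACA subrr add0r distrC.
  - exists (b * B) => i x; rewrite /Phi normrN.
    by apply: le_trans (split_S spl _) _; rewrite ler_wpM2l.
  - move=> u cu i; apply: metric_continuousN; apply: (metric_continuous_comp contS).
    apply: (metric_continuous_comp (metric_continuous_lipschitz (Ll i))).
    exact: metric_continuousD.
pose G i y := S y + g i y.
have fG i y : T (G i y) + L i (G i y) = y.
  by rewrite /G {1}gE /Phi raddfB /= !(split_SK spl) subrK.
exists G; split=> //.
- by move=> i; apply: metric_continuousD.
- move=> i x; set y := G _ _.
  have yx : T (y - x) = L i x - L i y.
    apply/eqP; rewrite raddfB /= subr_eq addrAC eq_sym subr_eq fG.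
    by rewrite addrC.
  have : `|y - x| <= (b * l) * `|y - x|.
    rewrite -{1}(split_TK spl (y - x)) yx.
    apply: le_trans (split_S spl _) _; rewrite -mulrA ler_wpM2l //.
    by rewrite [`|y - x|]distrC; exact: Ll.
  rewrite -subr_ge0 -{2}[`|y - x|]mul1r -mulrBl nmulr_rge0 ?subr_lt0 //.
  by rewrite normr_le0 subr_eq0 => /eqP.
Qed.

(** Both composites of [h1 = id + u] and [h2 = id + w] differ from the identity by a bounded family.
    That this family solves the equation for commuting with [T] or [F] does not yet make it 0; it is
    shown to be a fixed point of the corresponding [duhamel] operator, which also fixes 0. *)
Theorem nonautonomous_conjugacy L (l B : R) : 0 <= l -> 0 <= b ->
  lam + l < 1 -> b * l < 1 ->
  (forall i x y, `|L i x - L i y| <= l * `|x - y|) ->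
  (forall i x, `|L i x| <= B) ->
  exists h h' : I -> V -> V, [/\ forall i, metric_continuous (h i),
    forall i, metric_continuous (h' i), forall i, cancel (h i) (h' i),
    forall i, cancel (h' i) (h i) & forall i x, h (s i) (T x + L i x) = T (h i x)].
Proof.
move=> l0 b0 lam1 bl Ll LB.
have lam1' : lam + 0 < 1 by rewrite addr0; have /andP[] := split_lam spl.
have contL i : metric_continuous (L i) := metric_continuous_lipschitz (Ll i).
have [g [cg gF Fg]] := perturbation_inverse l0 bl b0 Ll LB.
(* [F i] leads from time [i] to time [s i], so its inverse [G] is indexed by the time of arrival. *)
pose F i x := T x + L i x; pose G i := g (s' i).
have cF i : metric_continuous (F i) by exact: metric_continuousD.
have GF i x : G (s i) (F i x) = x by rewrite /G sK gF.
have FG i x : F (s' i) (G i x) = x by rewrite /F Fg.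
(* The equation for [h1] is linear in [u]: the perturbation term does not involve the unknown and
   has Lipschitz constant 0. *)
pose v1 i x (y : V) := - L i x.
have [|||||u [bu cu uE]] := @duhamel_exists F G v1 0 B (lexx 0) lam1'.
- by move=> i x y z; rewrite subrr normr0 mul0r.
- by move=> i x; rewrite normrN.
- exact: cF.
- by move=> i; exact: cg.
- by move=> q _ i; exact: metric_continuousN.
pose v2 i x y := L i (x + y).
have [|||||w [bw cw wE]] := @duhamel_exists (fun _ => T) (fun _ => S) v2 l B l0 lam1.
- move=> i x y z; apply: le_trans (Ll _ _ _) _.
  by rewrite opprD addrACA subrr add0r.
- by move=> i x; exact: LB.
- by [].
- by [].
- move=> q cq i; apply: (metric_continuous_comp (contL i)).
  by apply: metric_continuousD => //; exact: metric_continuous_id.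
pose h1 i x := x + u i x; pose h2 i x := x + w i x.
have h1F i x : h1 (s i) (F i x) = T (h1 i x).
  by rewrite /h1 (duhamel_solution GF uE) raddfD /v1 /F addrACA subrr addr0.
have h2F i x : h2 (s i) (T x) = F i (h2 i x).
  rewrite /h2 (duhamel_solution (F := fun _ => T) (G := fun _ => S) _ wE); last first.
    by move=> j y; exact: split_TK.
  by rewrite /F raddfD addrA.
have h1G i x : h1 (s' i) (G i x) = S (h1 i x).
  by have := h1F (s' i) (G i x); rewrite s'K FG => ->; rewrite (split_TK spl).
have h2G i x : h2 (s' i) (S x) = G i (h2 i x).
  have := h2F (s' i) (S x); rewrite s'K (split_SK spl) => ->.
  by have := GF (s' i) (h2 (s' i) (S x)); rewrite s'K.
have b00 : sup_bounded (fun (i : I) (x : V) => 0 : V).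
  by exists 0 => i x; rewrite normr0.
have bD q r (k : I -> V -> V) : sup_bounded q -> sup_bounded r ->
    sup_bounded (fun i x => q i x + r i (k i x)).
  move=> [c qc] [d rd]; exists (c + d) => i x.
  by apply: le_trans (ler_normD _ _) _; exact: lerD.
have h12 i x : w i x + u i (h2 i x) = 0.
  pose v3 (i : I) (x y : V) : V := 0.
  apply: (@duhamel_unique (fun _ => T) (fun _ => S) v3 0
    (fun i x => w i x + u i (h2 i x)) (fun _ _ => 0) (lexx 0) lam1') => //.
  - by move=> ? ? ? ?; rewrite subrr normr0 mul0r.
  - exact: bD.
  (* The equation of [w] at [y] is added to that of [u] at [h2 j y]; by [h2G] and [h2F] both run
     along the same orbit, and the terms in [L] cancel. *)
  - move=> j y; rewrite {1}wE {1}uE /duhamel -h2G -h2F /v1 /v2 /v3 -/(h2 _ _) !raddf0.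
    rewrite -/(h2 j y) !raddfD /= !raddfN /=.
    rewrite !addr0 opprK addrACA; congr (_ + _).
      by rewrite addrACA subrr addr0.
    by rewrite addrACA addNr addr0.
  - by move=> j y; rewrite /duhamel !raddf0 !addr0.
have h21 i x : u i x + w i (h1 i x) = 0.
  (* The term for which [id + z] commutes with [F]: [F i (x + z) - F i x = T z + v3 i x z]. *)
  pose v3 i x y := L i (x + y) - L i x.
  apply: (@duhamel_unique F G v3 l
    (fun i x => u i x + w i (h1 i x)) (fun _ _ => 0) l0 lam1) => //.
  - move=> j y z z'; rewrite /v3 opprB addrA subrK; apply: le_trans (Ll _ _ _) _.
    by rewrite opprD addrACA subrr add0r.
  - exact: bD.
  - move=> j y; rewrite {1}uE {1}wE /duhamel -h1G -h1F /v1 /v2 /v3 /h1.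
    rewrite !raddfD /= !raddfN /=.
    rewrite -!(addrA y) -!(addrA (G j y)) addrACA.
    by congr (_ + _); rewrite addrACA; congr (_ + _); rewrite addrC.
  - by move=> j y; rewrite /duhamel /v3 !addr0 !subrr !raddf0 !addr0.
exists h1, h2; split=> //.
- by move=> i; apply: metric_continuousD => //; exact: metric_continuous_id.
- by move=> i; apply: metric_continuousD => //; exact: metric_continuous_id.
- by move=> i x; rewrite /h2 {1}/h1 -addrA h21 addr0.
- by move=> i x; rewrite /h1 {1}/h2 -addrA h12 addr0.
Qed.

End AdaptedSplitting.

(** * From the spectrum to a contracting power *)

Section ComplexScalars.
Context (R : realType).
Local Open Scope complex_scope.

(** The l1 modulus, real-valued: a complex scalar enlarges |x| + |y| on a complexification by at
    most this factor. *)
Definition cabs (z : R[i]) : R := `|complex.Re z| + `|complex.Im z|.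

Lemma cabs_ge0 z : 0 <= cabs z.
Proof. by rewrite addr_ge0. Qed.

Lemma cabs_real (r : R) : cabs r%:C = `|r|.
Proof. by rewrite /cabs /= normr0 addr0. Qed.

Lemma cabsM_real z (r : R) : cabs (z * r%:C) = cabs z * `|r|.
Proof. by case: z => a b; rewrite /cabs /= !mulr0 subr0 add0r !normrM mulrDl. Qed.

Lemma normc_le1 (z : R[i]) :
  (`|z| <= 1) = (complex.Re z ^+ 2 + complex.Im z ^+ 2 <= 1).
Proof.
rewrite normc_def (_ : 1 = 1%:C) // lecR -[X in _ <= X]sqrtr1 ler_sqrt //.
Qed.

Lemma cabs_le2 (z : R[i]) : `|z| <= 1 -> cabs z <= 2.
Proof.
rewrite normc_le1 /cabs -[complex.Re z ^+ 2]real_normK ?num_real //.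
rewrite -[complex.Im z ^+ 2]real_normK ?num_real // => H.
have := sqr_ge0 (`|complex.Re z| - 1); have := sqr_ge0 (`|complex.Im z| - 1).
by move: H; rewrite !sqrrB1; lra.
Qed.

Lemma sqrt_in_disc (z : R[i]) : `|z| <= 1 -> exists2 v, `|v| <= 1 & z = v * v.
Proof.
move=> z1; exists (sqrtc z); last by rewrite -expr2 sqr_sqrtc.
by rewrite -(@expr_le1 _ 2) // -normrX sqr_sqrtc.
Qed.

End ComplexScalars.

(** * Resolvents of the powers A^(2^k) on the closed disc *)

Section UniformStability.
Context (R : realType) (V : lmodType R[i]) (nu : V -> R) (M : set V)
  (A : {linear V -> V}).
Local Open Scope complex_scope.

(* For the complexification (x, y) of a real space, |x| + |y| is such a gauge
   but not a complex norm. *)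
Record complex_gauge : Prop := ComplexGauge {
  gaugeD : forall x y, nu (x + y) <= nu x + nu y;
  gaugeZ : forall c x, nu (c *: x) <= cabs c * nu x;
  gauge_ge0 : forall x, 0 <= nu x }.

Hypothesis gnu : complex_gauge.
Hypotheses (MD : forall x y, M x -> M y -> M (x + y))
  (MZ : forall c x, M x -> M (c *: x)) (MA : forall x, M x -> M (A x)).

Let MB x y : M x -> M y -> M (x - y).
Proof. by move=> Mx My; apply: MD => //; rewrite -scaleN1r; exact: MZ. Qed.

Let Miter n x : M x -> M (iter n A x).
Proof. by move=> Mx; elim: n => //= n; exact: MA. Qed.

Let iterL n c x y : iter n A (x + c *: y) = iter n A x + c *: iter n A y.
Proof. by elim: n => //= n ->; rewrite linearD linearZ. Qed.

Let iterB n x y : iter n A (x - y) = iter n A x - iter n A y.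
Proof. by rewrite -scaleN1r iterL scaleN1r. Qed.

Let nuN x : nu (- x) = nu x.
Proof.
suff H y : nu (- y) <= nu y by apply: le_anti; rewrite H -{1}[x]opprK H.
rewrite -scaleN1r; apply: le_trans (gaugeZ gnu _ _) _.
by rewrite /cabs /= normrN normr1 oppr0 normr0 addr0 mul1r.
Qed.

Let nu_half x y : nu (2^-1 *: (x + y)) <= (nu x + nu y) / 2.
Proof.
apply: le_trans (gaugeZ gnu _ _) _.
have -> : (2^-1 : R[i]) = (2^-1 : R)%:C by rewrite fmorphV rmorph_nat.
by rewrite cabs_real ger0_norm ?invr_ge0 // mulrC ler_wpM2r ?invr_ge0 // gaugeD.
Qed.

(** Together with [resolvent_surj], it says that 1 - z A^n has an inverse on [M] bounded by [K],
    without naming the inverse. *)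
Definition resolvent_bound (K : R) n := forall z, `|z| <= 1 ->
  forall x, M x -> nu x <= K * nu (x - z *: iter n A x).

Definition resolvent_surj n := forall z, `|z| <= 1 ->
  forall y, M y -> exists2 x, M x & x - z *: iter n A x = y.

(** Here [x] and [x'] are the values at [r = s] and [r = t] of (1 - u r^n A^n)^-1 y for a common y.
    The power r^n keeps [s] and [t] unchanged when [n] doubles: for u = v^2, u r^(2n) = (v
    r^n)^2. *)
Definition resolvent_lipschitz (D : R) n := forall u (s t : R), `|u| <= 1 ->
  0 <= s <= 1 -> 0 <= t <= 1 -> forall x x', M x -> M x' ->
  x - (u * (s ^+ n)%:C) *: iter n A x = x' - (u * (t ^+ n)%:C) *: iter n A x' ->
  nu (x - x') <= D * `|s - t| * nu (x - (u * (s ^+ n)%:C) *: iter n A x).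

Let factor n v x :
  x - (v * v) *: iter (n + n) A x =
  (x + v *: iter n A x) - v *: iter n A (x + v *: iter n A x).
Proof.
rewrite iterD iterL scalerDr scalerA opprD addrA; congr (_ - _).
by rewrite addrK.
Qed.

Let factorN n v x :
  x - (v * v) *: iter (n + n) A x =
  (x + (- v) *: iter n A x) - (- v) *: iter n A (x + (- v) *: iter n A x).
Proof. by rewrite -factor mulrNN. Qed.

Let average (v : R[i]) (x y : V) : x = 2^-1 *: ((x + v *: y) + (x + (- v) *: y)).
Proof.
by rewrite scaleNr addrACA subrr addr0 -mulr2n -[x *+ 2]scaler_nat scalerA mulVf ?scale1r.
Qed.

(** [x] is the mean of (1 + v A^n) x and (1 - v A^n) x, and the complementary factor sends each of
    them to (1 - v^2 A^(2n)) x. Taking the mean leaves [K] unchanged. *)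
Lemma resolvent_bound_double K n :
  resolvent_bound K n -> resolvent_bound K (n + n).
Proof.
move=> HK z /sqrt_in_disc[v v1 ->] x Mx.
rewrite [X in nu X <= _](average v x (iter n A x)).
apply: le_trans (nu_half _ _) _.
have Mv c : M (x + c *: iter n A x) by apply: MD => //; apply/MZ/Miter.
have := HK v v1 _ (Mv v); rewrite -factor.
have := HK (- v); rewrite normrN => /(_ v1 _ (Mv (- v))); rewrite -factorN.
by lra.
Qed.

Lemma resolvent_surj_double n : resolvent_surj n -> resolvent_surj (n + n).
Proof.
move=> Hs z /sqrt_in_disc[v v1 ->] y My.
have [x' Mx' <-] := Hs v v1 y My.
have [|x Mx <-] := Hs (- v) _ x' Mx'; first by rewrite normrN.
by exists x => //; rewrite factor scaleNr opprK.
Qed.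

(** The same mean, taken for [x] and for [x'], leaves [D] unchanged. *)
Lemma resolvent_lipschitz_double D n :
  resolvent_lipschitz D n -> resolvent_lipschitz D (n + n).
Proof.
move=> HD u s t /sqrt_in_disc[v v1 ->] s01 t01 x x' Mx Mx'.
have E (r : R) : v * v * (r ^+ (n + n))%:C = (v * (r ^+ n)%:C) * (v * (r ^+ n)%:C).
  by rewrite exprD rmorphM /= mulrACA.
rewrite !E // => xx'.
pose p (c : R[i]) (r : R) (z : V) := z + (c * (r ^+ n)%:C) *: iter n A z.
have Mp c r z : M z -> M (p c r z) by move=> Mz; apply: MD => //; apply/MZ/Miter.
have H c : (c = v \/ c = - v) -> nu (p c s x - p c t x') <=
    D * `|s - t| * nu (x - (v * (s ^+ n)%:C * (v * (s ^+ n)%:C)) *: iter (n + n) A x).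
  move=> cv; have c1 : `|c| <= 1 by case: cv => ->; rewrite ?normrN.
  have Ec (r : R) z : z - (v * (r ^+ n)%:C * (v * (r ^+ n)%:C)) *: iter (n + n) A z =
      p c r z - (c * (r ^+ n)%:C) *: iter n A (p c r z).
    by case: cv => ->; rewrite /p -factor // !mulNr mulrN opprK.
  by rewrite Ec; apply: HD => //; [exact: Mp|exact: Mp|rewrite -!Ec].
rewrite [X in nu (X - _)](average (v * (s ^+ n)%:C) x (iter n A x)).
rewrite [X in nu (_ - X)](average (v * (t ^+ n)%:C) x' (iter n A x')).
rewrite -scalerBr opprD addrACA; apply: le_trans (nu_half _ _) _.
have := H v (or_introl erefl); have := H (- v) (or_intror erefl).
rewrite /p !mulNr => H1 H2; lra.
Qed.

(** Resolvent identity: (1 - u s A)(x - x') = u (s - t) A x'. One [K] bounds [x - x'], the other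
    bounds [x'], and 2 bounds [cabs u]. *)
Lemma resolvent_lipschitz1 K a : 0 <= K -> 0 <= a ->
  (forall x, M x -> nu (A x) <= a * nu x) ->
  resolvent_bound K 1 -> resolvent_lipschitz (K * (2 * a * K)) 1.
Proof.
move=> K0 a0 Ha HK u s t u1 /andP[s0 s1] /andP[t0 t1] x x' Mx Mx' /=.
rewrite !expr1 => xx'.
have us1 (r : R) : 0 <= r -> r <= 1 -> `|u * r%:C| <= 1.
  move=> r0 r1; rewrite normrM mulr_ile1 //.
  by rewrite normc_def /= expr0n /= addr0 sqrtr_sqr lecR ger0_norm.
have : x - x' - (u * s%:C) *: A (x - x') = (u * (s - t)%:C) *: A x'.
  rewrite linearB /= scalerBr opprD addrACA -opprD xx' opprB addrC addrA subrK.
  by rewrite -scalerBl rmorphB /= mulrBr.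
move=> E; have := HK _ (us1 s s0 s1) _ (MB Mx Mx'); rewrite /= E => H.
apply: le_trans H _; rewrite -!mulrA ler_wpM2l //.
apply: le_trans (gaugeZ gnu _ _) _; rewrite cabsM_real.
have H2 : nu (A x') <= a * (K * nu (x - (u * s%:C) *: A x)).
  apply: le_trans (Ha _ Mx') _; rewrite ler_wpM2l // xx'; exact: HK (us1 t t0 t1) _ Mx'.
have H3 := cabs_le2 u1.
have H4 : cabs u * `|s - t| <= 2 * `|s - t| by rewrite ler_wpM2r.
apply: le_trans (ler_pM _ _ H4 H2) _; rewrite ?gauge_ge0 //.
  by rewrite mulr_ge0 // cabs_ge0.
by rewrite le_eqVlt; apply/orP; left; apply/eqP; ring.
Qed.

Definition power_small (eta t : R) n :=
  forall x, M x -> nu ((t ^+ n)%:C *: iter n A x) <= eta * nu x.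

(** With y = (1 - s^n A^n) x and x' = (1 - t^n A^n)^-1 y, the vector w = s^n A^n x equals (x - x') +
    (x' - y). Both terms are at most |y|/8, the second because x' - y = t^n A^n x'. So |w| <= |y|/4
    <= (|x| + |w|)/4, hence |w| <= |x|/3. *)
Lemma power_small_step K D eta s t n :
  resolvent_bound K n -> resolvent_surj n -> resolvent_lipschitz D n ->
  0 <= s <= 1 -> 0 <= t <= 1 -> D * `|s - t| <= 8^-1 ->
  0 <= eta -> eta * K <= 8^-1 -> power_small eta t n -> power_small 3^-1 s n.
Proof.
move=> HK Hs HD s01 t01 st eta0 etaK Ht x Mx.
have E1 (r : R) : (1 * (r ^+ n)%:C) = (r ^+ n)%:C :> R[i] by rewrite mul1r.
have r1 (r : R) : 0 <= r <= 1 -> `|(r ^+ n)%:C| <= 1 :> R[i].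
  move=> /andP[r0 r1]; rewrite normc_def /= expr0n /= addr0 sqrtr_sqr lecR.
  by rewrite normrX exprn_ile1 // ger0_norm.
set w := (s ^+ n)%:C *: _; pose y := x - w.
have My : M y by apply: MB => //; apply/MZ/Miter.
have [x' Mx' x'y] := Hs _ (r1 t t01) y My.
have H1 : nu (x - x') <= 8^-1 * nu y.
  have := HD 1 s t; rewrite !E1 normr1 => /(_ (lexx _) s01 t01 x x' Mx Mx').
  rewrite x'y -/w -/y => /(_ erefl) H; apply: le_trans H _.
  by rewrite ler_wpM2r // gauge_ge0.
have H2 : nu (x' - y) <= 8^-1 * nu y.
  have -> : x' - y = (t ^+ n)%:C *: iter n A x' by rewrite -x'y opprB addrC subrK.
  apply: le_trans (Ht _ Mx') _.
  have := HK _ (r1 t t01) _ Mx'; rewrite x'y => H.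
  apply: le_trans (ler_wpM2l eta0 H) _.
  by rewrite mulrA ler_wpM2r // gauge_ge0.
have H3 : nu w <= 4^-1 * nu y.
  have -> : w = (x - x') + (x' - y) by rewrite addrA subrK /y opprB addrC subrK.
  by have := gaugeD gnu (x - x') (x' - y); lra.
have : nu y <= nu x + nu w by rewrite -(nuN w) gaugeD.
by lra.
Qed.

Lemma power_contraction K a : 0 <= a ->
  (forall x, M x -> nu (A x) <= a * nu x) ->
  resolvent_bound K 1 -> resolvent_surj 1 ->
  exists2 n, (0 < n)%N & forall x, M x -> nu (iter n A x) <= 2^-1 * nu x.
Proof.
move=> a0 Ha HK0 Hs.
pose K1 := Num.max K 1; have K1ge : 1 <= K1 by rewrite le_max lexx orbT.
have K10 : 0 < K1 by rewrite (lt_le_trans ltr01).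
have HK : resolvent_bound K1 1.
  move=> z z1 x Mx; apply: le_trans (HK0 z z1 x Mx) _.
  by rewrite ler_wpM2r ?gauge_ge0 // le_max lexx.
pose D := K1 * (2 * a * K1).
have D0 : 0 <= D by rewrite !mulr_ge0 // ltW.
have HD : resolvent_lipschitz D 1 by apply: resolvent_lipschitz1 => //; exact: ltW.
have all2 k : [/\ resolvent_bound K1 (2 ^ k), resolvent_surj (2 ^ k)
    & resolvent_lipschitz D (2 ^ k)].
  elim: k => [|k [IH1 IH2 IH3]]; first by rewrite expn0.
  rewrite expnS mul2n -addnn; split.
  - exact: resolvent_bound_double.
  - exact: resolvent_surj_double.
  - exact: resolvent_lipschitz_double.
(* A stride of two nodes, of length 2/N, is short enough for [power_small_step]; [.+2] leaves room
   for the last stride, from node N - 2 to t = 1. *)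
pose N := (Num.bound (16 * D)).+2.
have N0 : 0 < N%:R :> R by rewrite ltr0n.
have DN : D * (2 / N%:R) <= 8^-1.
  have : 16 * D <= N%:R.
    apply: le_trans (ltW (archi_boundP _)) _; first by rewrite mulr_ge0.
    by rewrite ler_nat; exact: leqW (leqnSn _).
  by move=> ?; rewrite mulrA ler_pdivrMr //; lra.
pose t i : R := i%:R / N%:R.
have t01 i : (i <= N)%N -> 0 <= t i <= 1.
  by move=> iN; rewrite divr_ge0 //= ler_pdivrMr // mul1r ler_nat.
pose eta := (8 * K1)^-1.
have eta0 : 0 < eta by rewrite invr_gt0 mulr_gt0.
have etaK : eta * K1 <= 8^-1 by rewrite /eta invfM -mulrA mulVf ?mulr1 // gt_eqF.
have step i k : (i.+2 <= N)%N ->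
    power_small eta (t i) (2 ^ k) -> power_small 3^-1 (t i.+2) (2 ^ k).
  move=> iN; have [H1 H2 H3] := all2 k.
  apply: (power_small_step H1 H2 H3) => //; [exact: t01| |..].
  - by apply: t01; exact: leq_trans (leqW (leqnSn _)) iN.
  - rewrite /t -mulrBl -natrB; last exact: leqW (leqnSn _).
    by rewrite -[i.+2]addn2 addKn ger0_norm // divr_ge0.
  - exact: ltW.
(* At [t i.+2] only the bound 1/3 is known, but [t i.+1 = q * t i.+2] with q < 1 improves it to
   q^(2^k)/3. Smallness thus advances by one node. *)
have small i : (i.+2 <= N)%N -> forall e, 0 < e ->
    exists k0, forall k, (k0 <= k)%N -> power_small e (t i) (2 ^ k).
  elim: i => [_ e e0|i IH iN e e0].
    exists 0%N => k _ x Mx; rewrite /t mul0r expr0n expn_eq0 /= scale0r.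
    have := gaugeZ gnu 0 0; rewrite scale0r cabs_real normr0 mul0r => H.
    by apply: le_trans H _; rewrite mulr_ge0 ?gauge_ge0 // ltW.
  have iN' : (i.+2 <= N)%N by rewrite ltnW.
  have [k0 Hk0] := IH iN' _ eta0.
  pose q := t i.+1 / t i.+2.
  have t20 : 0 < t i.+2 by rewrite divr_gt0 // ltr0n.
  have q01 : 0 <= q < 1.
    rewrite divr_ge0 ?(ltW t20) ?divr_ge0 //= ltr_pdivrMr // mul1r.
    by rewrite ltr_pM2r ?invr_gt0 // ltr_nat.
  have [n0 Hn0] := geometric_small 3^-1 q01 e0.
  exists (maxn k0 n0) => k; rewrite geq_max => /andP[k0k n0k] x Mx.
  have -> : t i.+1 = q * t i.+2 by rewrite divfK // gt_eqF.
  rewrite exprMn mulrC rmorphM /= mulrC -scalerA.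
  apply: le_trans (gaugeZ gnu _ _) _.
  have /andP[q0 _] := q01.
  rewrite cabs_real ger0_norm ?exprn_ge0 //.
  have H := step i k iN' (Hk0 k k0k) x Mx.
  apply: le_trans (ler_wpM2l (exprn_ge0 _ q0) H) _.
  rewrite mulrA ler_wpM2r ?gauge_ge0 // mulrC ltW // Hn0 //.
  by rewrite (leq_trans n0k) // ltnW // ltn_expl.
have [k0 Hk0] := small N.-2 (leqnn _) eta eta0.
have := step N.-2 k0 (leqnn _) (Hk0 k0 (leqnn _)).
rewrite /power_small /= /t divff ?gt_eqF // expr1n => H.
exists (2 ^ k0)%N; first by rewrite expn_gt0.
move=> x Mx; have := H x Mx; rewrite scale1r => H1; apply: le_trans H1 _.
by rewrite ler_wpM2r ?gauge_ge0 // lef_pV2 ?posrE // ler_nat.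
Qed.

Hypothesis A_bounded : exists2 a, 0 <= a & forall x, M x -> nu (A x) <= a * nu x.

(** Each bound persists nearby with a doubled constant, and the disc, seen in [R * R], is compact.
    Letting [K] tend to +oo in the covering property gives one [K] for all points. *)
Lemma resolvent_bound_uniform :
  (forall z, `|z| <= 1 -> exists K, forall x, M x -> nu x <= K * nu (x - z *: A x)) ->
  exists K, resolvent_bound K 1.
Proof.
move=> HK; have [a a0 Ha] := A_bounded.
pose D : set (R * R) := (`[-1, 1] `*` `[-1, 1]) `&` [set p | p.1 ^+ 2 + p.2 ^+ 2 <= 1].
have /compact_near_coveringP cD : compact D.
  apply: compact_closedI; first by apply: compact_setX; exact: segment_compact.
  have -> : [set p : R * R | p.1 ^+ 2 + p.2 ^+ 2 <= 1] =
      (fun p : R * R => p.1 ^+ 2 + p.2 ^+ 2) @^-1` [set x | x <= 1] by [].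
  apply: closed_comp => [p _|]; last exact: closed_le.
  apply: cvgD; rewrite expr2; under eq_fun do rewrite expr2.
    by apply: cvgM; exact: cvg_fst.
  by apply: cvgM; exact: cvg_snd.
pose P (K : R) (p : R * R) :=
  forall x, M x -> nu x <= K * nu (x - (p.1 +i* p.2) *: A x).
have /cD : forall p, D p -> \forall p' \near p & K \near +oo, P K p'.
  move=> p [_ Dp]; have [|K0 H0] := HK (p.1 +i* p.2); first by rewrite normc_le1.
  pose K1 := Num.max K0 1; have K10 : 0 < K1 by rewrite lt_max ltr01 orbT.
  (* This radius makes K1 * 2d * a <= 1/2, so that the perturbation is absorbed by half of
     [nu x]. *)
  pose d := (4 * (K1 * a + 1))^-1.
  have Ka : 0 < K1 * a + 1 by rewrite ltr_wpDl // mulr_ge0 // ltW.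
  have d0 : 0 < d by rewrite invr_gt0 mulr_gt0.
  exists (ball p d, [set K | 2 * K1 <= K]).
    split; first exact: nbhsx_ballx.
    by exists (2 * K1); split; [exact: num_real | move=> K /ltW].
  move=> [p' K] [/= [b1 b2] KK] x Mx.
  have H1 : nu x <= K1 * nu (x - (p.1 +i* p.2) *: A x).
    by apply: le_trans (H0 x Mx) _; rewrite ler_wpM2r ?gauge_ge0 // le_max lexx.
  have E : x - (p.1 +i* p.2) *: A x = (x - (p'.1 +i* p'.2) *: A x)
      + ((p'.1 +i* p'.2) - (p.1 +i* p.2)) *: A x.
    by rewrite scalerBl addrA subrK.
  have H2 := gaugeD gnu (x - (p'.1 +i* p'.2) *: A x)
      (((p'.1 +i* p'.2) - (p.1 +i* p.2)) *: A x).
  rewrite -E in H2.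
  have H3 := gaugeZ gnu ((p'.1 +i* p'.2) - (p.1 +i* p.2)) (A x).
  have c2 : cabs ((p'.1 +i* p'.2) - (p.1 +i* p.2)) <= 2 * d.
    rewrite /cabs /= mulr2n mulrDl !mul1r.
    move: b1 b2; rewrite -!ball_normE /= ![`|p.1 - _|]distrC ![`|p.2 - _|]distrC.
    by move=> /ltW ? /ltW ?; apply: lerD.
  have H4 : cabs ((p'.1 +i* p'.2) - (p.1 +i* p.2)) * nu (A x) <= 2 * d * (a * nu x).
    by apply: ler_pM => //; [exact: cabs_ge0 | exact: gauge_ge0 | exact: Ha].
  have n0 := gauge_ge0 gnu (x - (p'.1 +i* p'.2) *: A x).
  apply: le_trans (_ : 2 * K1 * nu (x - (p'.1 +i* p'.2) *: A x) <= _); last first.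
    by rewrite ler_wpM2r.
  have H5 : K1 * (2 * d * (a * nu x)) <= 2^-1 * nu x.
    have -> : K1 * (2 * d * (a * nu x)) = (2 * d * (K1 * a)) * nu x by ring.
    rewrite ler_wpM2r ?gauge_ge0 // /d invfM.
    have -> : 2 * (4^-1 * (K1 * a + 1)^-1) * (K1 * a) = 2^-1 * ((K1 * a) / (K1 * a + 1)).
      by field; rewrite gt_eqF.
    by rewrite ler_piMr ?invr_ge0 // ler_pdivrMr // mul1r lerDl.
  have H6 := ler_wpM2l (ltW K10) H2.
  have H7 := ler_wpM2l (ltW K10) (le_trans H3 H4).
  by rewrite mulrDr in H6; lra.
case=> K [Kr HP]; exists (K + 1) => z z1 x Mx.
have := HP (K + 1); rewrite ltrDl ltr01 => /(_ isT (complex.Re z, complex.Im z)).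
case: z z1 => p q z1 /= H; apply: H => //.
move: z1; rewrite normc_le1 /= => pq1; split => //=.
by split; rewrite /= in_itv /= -ler_norml -(@expr_le1 _ 2) // real_normK ?num_real //;
  apply: le_trans pq1; rewrite ?lerDl ?lerDr sqr_ge0.
Qed.

End UniformStability.

(** * From the spectrum to resolvent bounds *)

Section SpectralContraction.
Context (R : realType) (V : preTopologicalLmodType R[i]) (nu : V -> R)
  (M : set V).
Local Open Scope complex_scope.

Hypothesis gnu : complex_gauge nu.
Hypotheses (M0 : M 0) (MD : forall x y, M x -> M y -> M (x + y))
  (MZ : forall c x, M x -> M (c *: x)).
Hypothesis nbhs_gauge :
  forall U, nbhs (0 : V) U <-> exists2 d : R, 0 < d & forall x, nu x < d -> U x.

(** Continuity of the inverse at 0 gives a radius [d] below which its values have gauge less than 1;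
    scaling by reals then gives K = 2/d. *)
Lemma invertible_on_bounded (f : {linear V -> V}) : invertible_on M f ->
  exists K, forall x, M x -> nu x <= K * nu (f x).
Proof.
move=> [[Mf _ _] [g [/subspace_continuousP cg Mg gf]]].
have g0 : g 0 = 0 by rewrite -[X in g X](linear0 f); case: (gf 0 M0).
have : within M (nbhs 0) (g @^-1` [set x | nu x < 1]).
  apply: (cg 0 M0); rewrite /from_subspace g0; apply/nbhs_gauge.
  by exists 1.
rewrite /within /= => /nbhs_gauge[d d0 Hd].
exists (2 / d) => x Mx; apply/ler_addgt0Pr => e e0.
(* [nu (f x)] may vanish, so a slack [e'] with 2e'/d = e is added before dividing. *)
pose e' := e * d / 2; pose r := nu (f x) + e'.
have e'0 : 0 < e' by rewrite divr_gt0 ?mulr_gt0.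
have r0 : 0 < r by rewrite ltr_wpDl // gauge_ge0.
pose c : R := d / (2 * r); have c0 : 0 < c by rewrite divr_gt0 // mulr_gt0.
have H1 : nu (c%:C *: f x) < d.
  apply: le_lt_trans (gaugeZ gnu _ _) _; rewrite cabs_real gtr0_norm //.
  apply: le_lt_trans (_ : c * r < _); first by rewrite ler_wpM2l ?(ltW c0) // lerDl ltW.
  by rewrite /c invfM mulrA divfK ?gt_eqF // ltr_pdivrMr // ltr_pMr // ltr1n.
have Mcx : M (c%:C *: x) by exact: MZ.
have := Hd _ H1; rewrite -linearZ => /(_ (Mf _ Mcx)) /=.
have [-> _] := gf _ Mcx => H2.
have cC : c%:C != 0 :> R[i] by rewrite (inj_eq (@complexI R) c 0) gt_eqF.
have : nu x <= c^-1.
  have -> : x = (c^-1)%:C *: (c%:C *: x).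
    by rewrite scalerA -rmorphM /= mulVf ?gt_eqF // scale1r.
  apply: le_trans (gaugeZ gnu _ _) _; rewrite cabs_real gtr0_norm ?invr_gt0 //.
  by apply: ler_piMr; rewrite ?invr_ge0; apply: ltW.
move=> /le_trans; apply.
rewrite /c invfM invrK /r mulrDr /e'.
by rewrite le_eqVlt; apply/orP; left; apply/eqP; field; rewrite gt_eqF.
Qed.

(** For 0 < |z| <= 1 one has 1 - zA = z (z^-1 - A), and z^-1 lies outside the open disc, hence
    outside the spectrum; z = 0 is trivial. *)
Lemma spectrum_contraction (A : {linear V -> V}) (a : R) :
  (forall x, M x -> M (A x)) -> 0 <= a ->
  (forall x, M x -> nu (A x) <= a * nu x) ->
  spectrum_on M A `<=` @open_unit_disc R ->
  exists2 n, (0 < n)%N & forall x, M x -> nu (iter n A x) <= 2^-1 * nu x.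
Proof.
move=> MA a0 Ha sA.
have inv z : z != 0 -> `|z| <= 1 -> invertible_on M (fun x => z^-1 *: x - A x).
  move=> z0 z1; apply: contrapT => /sA; rewrite /open_unit_disc /= normfV.
  by rewrite invf_lt1 ?normr_gt0 // le_gtF.
have fac z x : z != 0 -> x - z *: A x = z *: (z^-1 *: x - A x).
  by move=> z0; rewrite scalerBr scalerA mulfV // scale1r.
have [||K HK] := @resolvent_bound_uniform R V nu M A gnu.
- by exists a.
- move=> z z1; have [->|z0] := eqVneq z 0.
    by exists 1 => x Mx; rewrite scale0r subr0 mul1r.
  have lf : linear (fun x => z^-1 *: x - A x).
    move=> c x y; rewrite [A _]linearP scalerDr opprD addrACA; congr (_ + _).
    by rewrite scalerBr !scalerA mulrC.
  pose f : {linear V -> V} := HB.pack (fun x => z^-1 *: x - A x)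
    (GRing.isLinear.Build _ _ _ _ _ lf).
  have [K HK] := @invertible_on_bounded f (inv z z0 z1).
  exists (`|K| * cabs z^-1) => x Mx; apply: le_trans (HK x Mx) _.
  apply: le_trans (_ : `|K| * nu (f x) <= _).
    by rewrite ler_wpM2r ?gauge_ge0 // ler_norm.
  rewrite -mulrA ler_wpM2l //.
  have -> : f x = z^-1 *: (x - z *: A x) by rewrite fac // scalerA mulVf // scale1r.
  exact: gaugeZ.
- apply: (power_contraction gnu MD MZ MA a0 Ha HK) => z z1 y My.
  have [->|z0] := eqVneq z 0; first by exists y => //; rewrite scale0r subr0.
  have [[_ _ sf] _] := inv z z0 z1.
  have [x Mx fx] := sf (z^-1 *: y) (MZ _ My).
  by exists x => //=; rewrite fac // fx scalerA mulfV // scale1r.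
Qed.

End SpectralContraction.

(** * Reducing real and complex scalars to one real-valued norm *)

Section RealNorm.
Context (R : realType) (k : scalar_kind).
Local Open Scope complex_scope.

(** A section of [real_part] whose image contains all norms: relations between values of [rnorm] can
    be checked in the scalar field. *)
Definition real_scalar : R -> scalar_field R k :=
  match k with RealScalars => fun r => r | ComplexScalars => fun r => r%:C end.

Lemma ler_real_scalar r s : (real_scalar r <= real_scalar s) = (r <= s).
Proof. by rewrite /real_scalar; case: k => //; rewrite lecR. Qed.

Lemma ltr_real_scalar r s : (real_scalar r < real_scalar s) = (r < s).
Proof. by rewrite /real_scalar; case: k => //; rewrite ltcR. Qed.

Lemma real_scalar_inj : injective real_scalar.
Proof. by rewrite /real_scalar; case: k => // r s; exact: complexI. Qed.

Lemma real_scalarD r s : real_scalar (r + s) = real_scalar r + real_scalar s.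
Proof. by rewrite /real_scalar; case: k => //; rewrite rmorphD. Qed.

Lemma real_scalarM r s : real_scalar (r * s) = real_scalar r * real_scalar s.
Proof. by rewrite /real_scalar; case: k => //; rewrite rmorphM. Qed.

Lemma real_scalar0 : real_scalar 0 = 0.
Proof. by rewrite /real_scalar; case: k. Qed.

Lemma real_scalar1 : real_scalar 1 = 1.
Proof. by rewrite /real_scalar; case: k. Qed.

Lemma norm_real_scalar r : `|real_scalar r| = real_scalar `|r|.
Proof.
rewrite /real_scalar; case: k => //=.
by rewrite normc_def /= expr0n /= addr0 sqrtr_sqr.
Qed.

Lemma real_scalar_gt0P (e : scalar_field R k) : 0 < e ->
  exists2 r, 0 < r & e = real_scalar r.
Proof.
rewrite /real_scalar; case: k e => /= e e0; first by exists e.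
exists (complex.Re e); first by move: e0; rewrite ltcE => /andP[].
by rewrite RRe_real // gtr0_real.
Qed.

Context (X : normedModType (scalar_field R k)).
Implicit Types x y : X.

Lemma real_scalar_rnorm x : real_scalar (rnorm x) = `|x|.
Proof.
rewrite /real_scalar /rnorm /real_part; case: k X x => //= Y x.
by rewrite RRe_real // normr_real.
Qed.

Lemma rnormD x y : rnorm (x + y) <= rnorm x + rnorm y.
Proof. by rewrite -ler_real_scalar real_scalarD !real_scalar_rnorm ler_normD. Qed.

Lemma rnormN x : rnorm (- x) = rnorm x.
Proof. by apply: real_scalar_inj; rewrite !real_scalar_rnorm normrN. Qed.

Lemma rnorm_eq0 x : rnorm x = 0 -> x = 0.
Proof. by move=> x0; apply/normr0_eq0; rewrite -real_scalar_rnorm x0 real_scalar0. Qed.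

Lemma rnorm0 : rnorm (0 : X) = 0.
Proof. by apply: real_scalar_inj; rewrite real_scalar_rnorm normr0 real_scalar0. Qed.

Lemma rnorm_ge0 x : 0 <= rnorm x.
Proof. by rewrite -ler_real_scalar real_scalar_rnorm real_scalar0. Qed.

Lemma rnormMn x n : rnorm (x *+ n) = rnorm x *+ n.
Proof.
apply: real_scalar_inj; rewrite real_scalar_rnorm normrMn -real_scalar_rnorm.
by elim: n => [|n IH]; rewrite ?mulr0n ?real_scalar0 // !mulrS real_scalarD -IH.
Qed.

Lemma rnorm_group_norm : group_norm (@rnorm R k X).
Proof.
by split; [exact: rnormD | exact: rnorm_eq0 | exact: rnormMn | exact: rnormN].
Qed.

Lemma rnormZ r x : rnorm (real_scalar r *: x) = `|r| * rnorm x.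
Proof.
apply: real_scalar_inj.
by rewrite real_scalarM !real_scalar_rnorm normrZ norm_real_scalar.
Qed.

Lemma nbhs_rnorm x (U : set X) :
  nbhs x U <-> exists2 d : R, 0 < d & forall y, rnorm (x - y) < d -> U y.
Proof.
split=> [/nbhs_ballP[e /= /real_scalar_gt0P[r r0 ->] Hr]|[d d0 Hd]].
  exists r => // y yr; apply: Hr; rewrite -ball_normE /=.
  by rewrite -real_scalar_rnorm ltr_real_scalar.
apply/nbhs_ballP; exists (real_scalar d).
  by rewrite /= -real_scalar0 ltr_real_scalar.
by move=> y; rewrite -ball_normE /= -real_scalar_rnorm ltr_real_scalar; exact: Hd.
Qed.

Lemma continuous_rnorm (f : X -> X) : continuous f <-> forall x (e : R), 0 < e ->
  exists2 d : R, 0 < d & forall y, rnorm (x - y) < d -> rnorm (f x - f y) < e.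
Proof.
split=> [cf x e e0|Hf x U /nbhs_rnorm[e e0 He]].
  have /cf/nbhs_rnorm[d d0 Hd] : nbhs (f x) [set y | rnorm (f x - y) < e].
    by apply/nbhs_rnorm; exists e.
  by exists d.
apply/nbhs_rnorm; have [d d0 Hd] := Hf x e e0.
by exists d => // y /Hd; exact: He.
Qed.

Lemma continuous_linear_rnorm (f : {linear X -> X}) : continuous f ->
  exists2 a : R, 0 <= a & forall x, rnorm (f x) <= a * rnorm x.
Proof.
move=> /continuous_rnorm/(_ 0 1 ltr01)[d d0 Hd].
exists (2 / d); first by rewrite divr_ge0 // ltW.
move=> x; have [->|x0] := eqVneq x 0; first by rewrite linear0 rnorm0 mulr0.
have r0 : 0 < rnorm x.
  by rewrite lt_neqAle rnorm_ge0 andbT eq_sym; apply: contra_neq x0; exact: rnorm_eq0.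
pose c := d / (2 * rnorm x); have c0 : 0 < c by rewrite divr_gt0 // mulr_gt0.
have := Hd (real_scalar c *: x).
rewrite !sub0r linear0 sub0r !rnormN linearZ !rnormZ gtr0_norm //.
have -> : c * rnorm x = d / 2 by rewrite /c; field; rewrite gt_eqF.
rewrite ltr_pdivrMr // ltr_pMr // ltr1n => /(_ isT) /ltW.
rewrite mulrC -ler_pdivlMr // mul1r /c invf_div => /le_trans; apply.
by rewrite mulrAC.
Qed.

Lemma closed_rnorm (M : set X) x : closed M ->
  (forall e : R, 0 < e -> exists2 m, M m & rnorm (x - m) < e) -> M x.
Proof.
move=> cM Hx; apply: cM => U /nbhs_rnorm[d d0 Hd].
by have [m Mm mx] := Hx d d0; exists m; split=> //; exact: Hd.
Qed.

End RealNorm.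

Lemma rnorm_complete (R : realType) (k : scalar_kind)
    (X : completeNormedModType (scalar_field R k)) :
  geometrically_complete (renormed (rnorm_group_norm X)).
Proof.
move=> u C q q01 uq; have q1' : 0 < 1 - q by case/andP: q01; rewrite subr_gt0.
have tail n j : rnorm ((u (n + j)%N : X) - u n) <= C * q ^+ n / (1 - q).
  exact: (geometric_tail q01 uq).
have /cvg_ex[l ul] : cvg ((u : nat -> X) @ \oo).
  apply/cauchy_cvgP; apply: cauchy_exP => e /real_scalar_gt0P[r r0 ->].
  have [n0 Hn0] := geometric_small C q01 (mulr_gt0 r0 q1').
  exists (u n0), n0 => // n /= /subnKC <-.
  rewrite -ball_normE /= distrC -real_scalar_rnorm ltr_real_scalar.
  by apply: le_lt_trans (tail _ _) _; rewrite ltr_pdivrMr // Hn0.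
exists l => n; rewrite renormedE; apply/ler_addgt0Pr => e e0.
have : nbhs l [set y | rnorm (l - y) < e] by apply/nbhs_rnorm; exists e.
move=> /ul [m _ Hm].
have := Hm (n + m)%N (leq_addl _ _) => /= /ltW H1.
rewrite -[l](subrK (u (n + m)%N : X)) -addrA addrC; apply: le_trans (rnormD _ _) _.
by apply: lerD => //; exact: tail.
Qed.

Section Complexification.
Context (R : realType) (X : normedModType R).
Local Notation XC := (complexification X).

Definition complexify (A : X -> X) (z : XC) : XC := (A z.1, A z.2).

Lemma complexify_linear (A : {linear X -> X}) : linear (complexify A).
Proof.
move=> c [x1 y1] [x2 y2].
have H1 : A (complex.Re c *: x1 - complex.Im c *: y1 + x2) =
    complex.Re c *: A x1 - complex.Im c *: A y1 + A x2.
  by rewrite linearD linearB !linearZ.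
have H2 : A (complex.Re c *: y1 + complex.Im c *: x1 + y2) =
    complex.Re c *: A y1 + complex.Im c *: A x1 + A y2.
  by rewrite !linearD !linearZ.
exact: (f_equal2 pair H1 H2).
Qed.

Definition complexification_gauge (z : XC) : R := `|z.1| + `|z.2|.

Lemma complexification_gaugeP : complex_gauge complexification_gauge.
Proof.
split.
- move=> [x1 y1] [x2 y2]; rewrite /complexification_gauge /= addrACA.
  by apply: lerD; exact: ler_normD.
- move=> [a b] [x y]; rewrite /complexification_gauge /cabs /=.
  apply: le_trans (lerD (ler_normB _ _) (ler_normD _ _)) _.
  by rewrite !normrZ mulrDl !mulrDr; lra.
- by move=> z; rewrite addr_ge0.
Qed.

Lemma nbhs_complexification_gauge (U : set XC) : nbhs (0 : XC) U <->
  exists2 d : R, 0 < d & forall z, complexification_gauge z < d -> U z.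
Proof.
split=> [[[B C] /= [/nbhs_ballP[d /= d0 Bd] /nbhs_ballP[e /= e0 Ce]] BCU]|[d d0 Hd]].
  exists (Num.min d e); first by rewrite lt_min d0.
  move=> [x y]; rewrite lt_min /complexification_gauge /= => /andP[xd ye].
  apply: BCU; split=> /=.
    apply: Bd; rewrite -ball_normE /= sub0r normrN.
    by apply: le_lt_trans xd; rewrite lerDl.
  apply: Ce; rewrite -ball_normE /= sub0r normrN.
  by apply: le_lt_trans ye; rewrite lerDr.
exists (ball (0 : X) (d / 2), ball (0 : X) (d / 2)).
  by split; apply: nbhsx_ballx; rewrite divr_gt0.
move=> [x y] [/=]; rewrite -!ball_normE /= !sub0r !normrN => xd yd.
by apply: Hd; rewrite /complexification_gauge /= (splitr d) ltrD.
Qed.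

End Complexification.

Lemma closed_subspaceZ (K : numFieldType) (X : normedModType K) (M : set X) c x :
  closed_subspace M -> M x -> M (c *: x).
Proof.
move=> [_ [M0 Mlin]] Mx; have := Mlin c x 0; rewrite !inE addr0; apply => //.
by move: M0; rewrite inE.
Qed.

Lemma closed_subspaceD (K : numFieldType) (X : normedModType K) (M : set X) x y :
  closed_subspace M -> M x -> M y -> M (x + y).
Proof.
by move=> [_ [_ Mlin]] Mx My; have := Mlin 1 x y; rewrite !inE scale1r; apply.
Qed.

Lemma closed_subspaceB (K : numFieldType) (X : normedModType K) (M : set X) x y :
  closed_subspace M -> M x -> M y -> M (x - y).
Proof.
move=> sM Mx My; apply: closed_subspaceD => //; rewrite -scaleN1r.
exact: closed_subspaceZ.
Qed.

(** For real scalars the contraction is found on M + iM and read off at the vectors (x, 0). For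
    complex scalars [rnorm] is itself a gauge, since |c| <= |Re c| + |Im c|. *)
Lemma spectrum_restr_contraction (R : realType) (k : scalar_kind)
    (X : normedModType (scalar_field R k)) (M : set X) (A : {linear X -> X}) :
  closed_subspace M -> continuous A -> (forall x, M x -> M (A x)) ->
  spectrum_restr M A `<=` @open_unit_disc R ->
  exists2 n, (0 < n)%N & forall x, M x -> rnorm (iter n A x) <= 2^-1 * rnorm x.
Proof.
move=> sM cA MA.
have M0 : M 0 by case: sM => _ [+ _]; rewrite inE.
have MZ c x : M x -> M (c *: x) := closed_subspaceZ c sM.
have MD x y : M x -> M y -> M (x + y) := closed_subspaceD sM.
have [a a0 Ha] := continuous_linear_rnorm cA.
case: k X M A {sM cA} MA M0 MZ MD a a0 Ha => /= X M A MA M0 MZ MD a a0 Ha sA.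
  pose AC : {linear complexification X -> complexification X} :=
    HB.pack (complexify A) (GRing.isLinear.Build _ _ _ _ _ (complexify_linear A)).
  have [||||||n n0 Hn] := @spectrum_contraction R (complexification X)
    (@complexification_gauge R X) (M `*` M) (complexification_gaugeP X) _ _ _
    (@nbhs_complexification_gauge R X) AC a _ a0.
  - by split.
  - by move=> [x1 y1] [x2 y2] [/= ? ?] [/= ? ?]; split; exact: MD.
  - move=> [c d] [x y] [/= Mx My]; split => /=; last by apply: MD; exact: MZ.
    by apply: MD; [exact: MZ | rewrite -scaleNr; exact: MZ].
  - by move=> [x y] [/= Mx My]; split; exact: MA.
  - move=> [x y] _; rewrite /complexification_gauge /= mulrDr.
    by apply: lerD; exact: Ha.
  - exact: sA.
  exists n => // x Mx; have := Hn (x, 0) (conj Mx M0).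
  have -> : iter n AC (x, 0) = (iter n A x, 0).
    by elim: (n) => //= m ->; rewrite /complexify /= linear0.
  by rewrite /complexification_gauge /= normr0 !addr0.
have gX : complex_gauge (@rnorm R ComplexScalars X).
  split; [exact: (@rnormD R ComplexScalars X) | move=> c x |
    exact: (@rnorm_ge0 R ComplexScalars X)].
  rewrite -(@ler_real_scalar R ComplexScalars) real_scalarM !real_scalar_rnorm normrZ.
  rewrite ler_wpM2r // /cabs /= normc_def lecR.
  rewrite -[X in _ <= X]ger0_norm ?addr_ge0 // -sqrtr_sqr ler_wsqrtr // sqrrD.
  by rewrite !real_normK ?num_real // addrAC lerDl mulrn_wge0 // mulr_ge0.
have nX (U : set X) : nbhs (0 : X) U <->
    exists2 d : R, 0 < d & forall x, @rnorm R ComplexScalars X x < d -> U x.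
  rewrite (@nbhs_rnorm R ComplexScalars); split=> -[d d0 Hd]; exists d => // x.
    by move=> xd; apply: Hd; rewrite sub0r rnormN.
  by rewrite sub0r rnormN; exact: Hd.
exact: (@spectrum_contraction R X _ M gX M0 MD MZ nX A a MA a0 (fun x _ => Ha x) sA).
Qed.

(** * Boundedness of the projections *)

Section DirectSumBounded.
Context (R : realType) (V : normedZmodType R) (sc : R -> {additive V -> V}).
Hypotheses (norm_sc : forall r x, `|sc r x| = `|r| * `|x|)
  (scK : forall r, r != 0 -> cancel (sc r) (sc r^-1)).
Hypothesis complV : geometrically_complete V.

(** The telescoping bound [2 * r n - 2 * r (n + j)] keeps the estimate in terms of [r n] even when
    [r] decreases faster than by halves. *)
Lemma halving_limit (x : nat -> V) (r : nat -> R) : (forall n, 0 <= r n) ->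
  (forall n, r n.+1 <= r n / 2) -> (forall n, `|x n.+1 - x n| <= r n) ->
  exists l, forall n, `|l - x n| <= 2 * r n.
Proof.
move=> r0 rr xr.
have h01 : 0 <= (2^-1 : R) < 1 by rewrite invr_ge0 ler0n invf_lt1 // ltr1n.
have rn n : r n <= r 0%N * 2^-1 ^+ n.
  elim: n => [|n IH]; first by rewrite expr0 mulr1.
  by apply: le_trans (rr n) _; rewrite exprSr mulrA ler_wpM2r // invr_ge0.
have [l Hl] := complV h01 (fun n => le_trans (xr n) (rn n)).
exists l => n.
have tail j : `|x (n + j)%N - x n| <= 2 * r n - 2 * r (n + j)%N.
  elim: j => [|j IH]; first by rewrite addn0 !subrr normr0.
  rewrite addnS -[x _.+1](subrK (x (n + j)%N)) -addrA.
  apply: le_trans (ler_normD _ _) _.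
  by have := xr (n + j)%N; have := rr (n + j)%N; lra.
apply/ler_addgt0Pr => e e0.
have e20 : 0 < e / 2 by rewrite divr_gt0.
have [n0 Hn0] := geometric_small (r 0%N) h01 e20.
have := Hn0 (n + n0)%N (leq_addl _ _); have := Hl (n + n0)%N.
have -> : 1 - 2^-1 = 2^-1 :> R by lra.
rewrite invrK => H1 H2; have := tail n0; have := r0 (n + n0)%N => H3 H4.
have := ler_normD (l - x (n + n0)%N) (x (n + n0)%N - x n); rewrite addrA subrK.
by lra.
Qed.

Context (M N : set V).
Hypotheses (MB : forall x y, M x -> M y -> M (x - y))
  (NB : forall x y, N x -> N y -> N (x - y))
  (Msc : forall r x, M x -> M (sc r x)) (Nsc : forall r x, N x -> N (sc r x))
  (closedM : forall x, (forall e, 0 < e -> exists2 m, M m & `|x - m| < e) -> M x)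
  (closedN : forall x, (forall e, 0 < e -> exists2 m, N m & `|x - m| < e) -> N x)
  (MN : forall x, exists m n, [/\ M m, N n & x = m + n])
  (MN0 : forall x, M x -> N x -> x = 0).

(** The image of the ball of radius [c] of M x N: what follows is the open mapping argument for (m,
    n) |-> m + n. *)
Let A (c : R) : set V :=
  [set x | exists m n, [/\ M m, N n, x = m + n, `|m| <= c & `|n| <= c]].

Let AB c c' x y : A c x -> A c' y -> A (c + c') (x - y).
Proof.
move=> [m [n [Mm Nn -> mc nc]]] [m' [n' [Mm' Nn' -> mc' nc']]].
exists (m - m'), (n - n'); split; [exact: MB|exact: NB| | |].
- by rewrite opprD addrACA.
- by apply: le_trans (ler_normB _ _) _; exact: lerD.
- by apply: le_trans (ler_normB _ _) _; exact: lerD.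
Qed.

Let Asc c (r : R) x : A c x -> A (`|r| * c) (sc r x).
Proof.
move=> [m [n [Mm Nn -> mc nc]]]; exists (sc r m), (sc r n).
by split; [exact: Msc|exact: Nsc|rewrite raddfD|rewrite norm_sc ler_wpM2l|
  rewrite norm_sc ler_wpM2l].
Qed.

(** Baire's argument: otherwise there are shrinking balls whose centre number c + 1 stays away from
    [A c], and the limit of the centres lies in no [A c], although it decomposes along [M] and
    [N]. *)
Let A_somewhere_dense : exists (c : nat) x0 (r : R), 0 < r /\
  forall y, `|y - x0| < r -> forall e, 0 < e -> exists2 z, A c%:R z & `|y - z| < e.
Proof.
apply: contrapT => H.
(* The margin of 4 new radii beats the 2 radii that separate the new centre from the limit. *)
have step (cxr : nat * (V * R)) : exists xr : V * R, 0 < cxr.2.2 ->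
    [/\ `|xr.1 - cxr.2.1| <= cxr.2.2, 0 < xr.2, xr.2 <= cxr.2.2 / 2
      & forall z, A cxr.1%:R z -> 4 * xr.2 <= `|xr.1 - z|].
  case: cxr => c [x0 r] /=; have [r0|] := ltP 0 r; last by exists (0, 0).
  apply: contrapT => H'; apply: H; exists c, x0, r; split=> // y yr e e0.
  apply: contrapT => He; apply: H'; exists (y, Num.min (r / 2) (e / 4)) => _ /=; split.
  - exact: ltW.
  - by rewrite lt_min !divr_gt0.
  - by rewrite ge_min lexx.
  - move=> z Az; rewrite mulrC -ler_pdivlMr // ge_min; apply/orP; right.
    rewrite ler_wpM2r ?invr_ge0 // leNgt; apply/negP => yz.
    by apply: He; exists z.
have [f Hf] := choice step.
pose s := fix s n : V * R := if n is m.+1 then f (m, s m) else (0, 1).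
have s0 n : 0 < (s n).2.
  by elim: n => [|n IH] /=; [exact: ltr01 | case: (Hf (n, s n) IH)].
have [||| l Hl] := @halving_limit (fun n => (s n).1) (fun n => (s n).2).
- by move=> n; exact: ltW.
- by move=> n; case: (Hf (n, s n) (s0 n)).
- by move=> n; case: (Hf (n, s n) (s0 n)).
have [m [n [Mm Nn lmn]]] := MN l.
pose c := Num.bound (Num.max `|m| `|n|).
have /archi_boundP : 0 <= Num.max `|m| `|n| by rewrite le_max normr_ge0.
rewrite -/c gt_max => /andP[/ltW mc /ltW nc].
have Al : A c%:R l by exists m, n.
have [_ sc0 _ /(_ _ Al) H1] := Hf (c, s c) (s0 c).
have := Hl c.+1 => /=; rewrite distrC => H2.
by have := le_trans H1 H2; rewrite ler_pM2r // ler_nat.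
Qed.

(** Subtracting approximations of [x0 + sc q y] and of [x0] moves the dense ball to the origin at
    the cost of doubling [c]; scaling then reaches every radius. *)
Let A_dense_at0 : exists2 k : R, 0 <= k & forall y (r : R), 0 < r -> `|y| < r ->
  forall e, 0 < e -> exists2 z, A (k * r) z & `|y - z| < e.
Proof.
have [c [x0 [r [r0 H]]]] := A_somewhere_dense.
exists (2 * c%:R / r); first by apply: divr_ge0; [exact: mulr_ge0 | exact: ltW].
move=> y t t0 yt e e0; pose q := r / t.
have q0 : 0 < q by rewrite divr_gt0.
have qe : 0 < q * e / 2 by apply: divr_gt0 => //; exact: mulr_gt0.
have [|z1 Az1 z1y] := H (x0 + sc q y) _ _ qe.
  by rewrite addrC addKr norm_sc gtr0_norm // /q mulrAC ltr_pdivrMr // ltr_pM2l.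
have [|z2 Az2 z2y] := H x0 _ _ qe; first by rewrite subrr normr0.
exists (sc q^-1 (z1 - z2)).
  have -> : 2 * c%:R / r * t = `|q^-1| * (c%:R + c%:R).
    by rewrite gtr0_norm ?invr_gt0 // /q invf_div; ring.
  exact/Asc/AB.
rewrite -[y](scK (lt0r_neq0 q0)) -raddfB norm_sc gtr0_norm ?invr_gt0 //.
rewrite ltr_pdivrMl //.
have -> : sc q y - (z1 - z2) = (x0 + sc q y - z1) - (x0 - z2).
  by rewrite !opprB [RHS]addrC -!addrA addKr addrCA.
by apply: le_lt_trans (ler_normB _ _) _; lra.
Qed.

(** The remainder of [m + n] is approximated again and again, with components bounded by [k * rr j].
    Their sums converge in [M] and in [N] by closedness, and uniqueness of the decomposition
    identifies the limit in [M] with [m]. *)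
Lemma direct_sum_bounded :
  exists C : R, forall m n, M m -> N n -> `|m| <= C * `|m + n|.
Proof.
have [k k0 Hk] := A_dense_at0; exists (2 * k) => m n Mm Nn.
(* The scheme needs a radius strictly above |m + n|, which also covers |m + n| = 0; it is lowered to
   |m + n| afterwards. *)
suff H r : `|m + n| < r -> `|m| <= 2 * k * r.
  apply/ler_addgt0Pr => e e0.
  pose d := e / (2 * k + 1); have k1 : 0 < 2 * k + 1 by apply: ltr_wpDl => //; exact: mulr_ge0.
  have d0 : 0 < d by rewrite divr_gt0.
  have := H (`|m + n| + d); rewrite ltrDl => /(_ d0) H1; apply: le_trans H1 _.
  rewrite mulrDr lerD2l /d mulrA ler_pdivrMr // mulrC ler_pM2l //.
  by rewrite lerDl.
move=> mnr; have r0 : 0 < r by apply: le_lt_trans mnr.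
pose y0 := m + n; pose rr j := r * 2^-1 ^+ j.
have rr0 j : 0 < rr j by rewrite mulr_gt0 // exprn_gt0 // invr_gt0.
have rrS j : rr j.+1 = rr j / 2 by rewrite /rr exprSr mulrA.
have step (jy : nat * V) : exists mn : V * V, `|jy.2| < rr jy.1 ->
    [/\ M mn.1, N mn.2, `|mn.1| <= k * rr jy.1, `|mn.2| <= k * rr jy.1
      & `|jy.2 - (mn.1 + mn.2)| < rr jy.1.+1].
  case: jy => j y /=; have [yr|yr] := ltP `|y| (rr j); last by exists (0, 0).
  have [z [a [b [Ma Nb -> ac bc]]] yz] := Hk y _ (rr0 j) yr _ (rr0 j.+1).
  by exists (a, b).
have [f Hf] := choice step.
pose y := fix y j : V := if j is i.+1 then y i - ((f (i, y i)).1 + (f (i, y i)).2) else y0.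
have yr j : `|y j| < rr j.
  elim: j => [|j IH] /=; first by rewrite /rr expr0 mulr1.
  by case: (Hf (j, y j) IH).
pose a := fix a j : V := if j is i.+1 then a i + (f (i, y i)).1 else 0.
pose b := fix b j : V := if j is i.+1 then b i + (f (i, y i)).2 else 0.
have sum j : a j + b j + y j = y0.
  elim: j => [|j IH] /=; first by rewrite !add0r.
  by rewrite [X in X + _]addrACA -[RHS]IH -[LHS]addrA; congr (_ + _); rewrite addrC subrK.
have M0 : M 0 by rewrite -(subrr m); exact: MB.
have N0 : N 0 by rewrite -(subrr n); exact: NB.
have MD u v : M u -> M v -> M (u + v).
  by move=> Mu Mv; rewrite -[v]opprK; apply: MB => //; rewrite -sub0r; exact: MB.
have ND u v : N u -> N v -> N (u + v).
  by move=> Nu Nv; rewrite -[v]opprK; apply: NB => //; rewrite -sub0r; exact: NB.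
have Ma j : M (a j).
  by elim: j => //= j IH; apply: MD => //; case: (Hf (j, y j) (yr j)).
have Nb j : N (b j).
  by elim: j => //= j IH; apply: ND => //; case: (Hf (j, y j) (yr j)).
have krr0 j : 0 <= k * rr j by rewrite mulr_ge0 // ltW.
have krrS j : k * rr j.+1 <= k * rr j / 2 by rewrite rrS mulrA.
have [|l Hl] := halving_limit krr0 krrS (x := a).
  by move=> j; rewrite /= addrC addKr; case: (Hf (j, y j) (yr j)).
have [|l' Hl'] := halving_limit krr0 krrS (x := b).
  by move=> j; rewrite /= addrC addKr; case: (Hf (j, y j) (yr j)).
have h01 : 0 <= (2^-1 : R) < 1 by rewrite invr_ge0 ler0n invf_lt1 // ltr1n.
have small e : 0 < e -> exists j, 2 * (k * rr j) < e.
  move=> e0; have [j Hj] := geometric_small (2 * k * r) h01 e0.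
  by exists j; have := Hj j (leqnn _); rewrite /rr !mulrA.
have Ml : M l.
  apply: closedM => e /small[j Hj]; exists (a j) => //.
  exact: le_lt_trans (Hl j) _.
have Nl' : N l'.
  apply: closedN => e /small[j Hj]; exists (b j) => //.
  exact: le_lt_trans (Hl' j) _.
have yl : m + n = l + l'.
  apply/eqP; rewrite -subr_eq0 -normr_le0.
  apply: (@geometric_dominated0 _ _ ((4 * k + 1) * r) _ h01) => j.
  have -> : m + n - (l + l') = y j - ((l - a j) + (l' - b j)).
    by rewrite -/y0 -(sum j) [l - _ + _]addrACA -opprD opprB addrA [y j + _]addrC.
  apply: le_trans (ler_normB _ _) _.
  have := ler_normD (l - a j) (l' - b j); have := Hl j; have := Hl' j.
  by have := yr j; rewrite /rr; lra.
have : m - l = 0.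
  apply: MN0; first exact: MB.
  have -> : m - l = l' - n by apply/eqP; rewrite subr_eq addrAC eq_sym subr_eq addrC yl addrC.
  exact: NB.
move/eqP; rewrite subr_eq0 => /eqP ->.
by have := Hl 0%N; rewrite /rr expr0 mulr1 subr0 mulrA.
Qed.

End DirectSumBounded.

Lemma direct_sum_projections (R : realType) (k : scalar_kind)
  (X : completeNormedModType (scalar_field R k)) (M N : set X) :
  closed_subspace M -> closed_subspace N -> direct_sum M N ->
  exists (P Q : {additive X -> X}) (C : R), [/\ 0 <= C,
    forall x, [/\ M (P x), N (Q x) & P x + Q x = x],
    forall x, M x -> P x = x,
    forall x, N x -> P x = 0
    & forall x, rnorm (P x) <= C * rnorm x /\ rnorm (Q x) <= C * rnorm x].
Proof.
move=> sM sN [MN MN0].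
have MB x y : M x -> M y -> M (x - y) := closed_subspaceB sM.
have NB x y : N x -> N y -> N (x - y) := closed_subspaceB sN.
have disj x : M x -> N x -> x = 0.
  by move=> Mx Nx; have : (M `&` N) x by []; rewrite MN0.
have uniq m n m' n' : M m -> N n -> M m' -> N n' -> m + n = m' + n' -> m = m'.
  move=> Mm Nn Mm' Nn' /eqP E; apply/eqP; rewrite -subr_eq0; apply/eqP.
  apply: disj; first exact: MB.
  have -> : m - m' = n' - n.
    by apply/eqP; rewrite subr_eq addrAC eq_sym subr_eq addrC eq_sym addrC [n' + _]addrC.
  exact: NB.
have [p Hp] := choice MN.
have Mp x : M (p x) by have [? []] := Hp x.
have Np x : N (x - p x).
  by have [n [_ Nn xE]] := Hp x; rewrite {1}xE addrC addKr.
have pK z : p z + (z - p z) = z by rewrite addrC subrK.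
have pB : zmod_morphism p.
  move=> x y; apply: (@uniq _ (x - y - p (x - y)) _ ((x - p x) - (y - p y))) => //.
  - exact: MB.
  - exact: NB.
  - by rewrite pK addrACA -opprD !pK.
pose P : {additive X -> X} := HB.pack p (GRing.isZmodMorphism.Build _ _ p pB).
have qB : zmod_morphism (fun x => x - p x).
  by move=> x y; rewrite pB opprD addrACA -opprD.
pose Q : {additive X -> X} := HB.pack (fun x => x - p x)
  (GRing.isZmodMorphism.Build _ _ (fun x => x - p x) qB).
pose V : normedZmodType R := renormed (rnorm_group_norm X).
have scB r : zmod_morphism (fun x : V => real_scalar k r *: (x : X) : V).
  by move=> x y; rewrite -scalerBr.
pose sc r : {additive V -> V} := HB.pack (fun x : V => real_scalar k r *: (x : X) : V)
  (GRing.isZmodMorphism.Build V V _ (scB r)).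
have [||||||||C HC] := @direct_sum_bounded R V sc _ _ (@rnorm_complete R k X) M N MB NB.
- by move=> r x; exact: rnormZ.
- move=> r r0 x /=; rewrite scalerA -real_scalarM mulVf // real_scalar1.
  exact: scale1r.
- by move=> r x Mx; exact: closed_subspaceZ.
- by move=> r x Mx; exact: closed_subspaceZ.
- by move=> x; exact: (closed_rnorm sM.1).
- by move=> x; exact: (closed_rnorm sN.1).
- by move=> x; exact: MN.
- exact: disj.
(* |C| suffices for [P]; [Q = id - P] costs 1 more. *)
exists P, Q, (`|C| + 1).
have PC x : rnorm (P x) <= `|C| * rnorm x.
  have := HC (p x) (x - p x) (Mp x) (Np x).
  have -> : p x + (x - p x) = x by rewrite addrC subrK.
  move=> /le_trans; apply; apply: ler_wpM2r; last exact: ler_norm.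
  exact: (@rnorm_ge0 R k X x).
have C0 : 0 <= `|C| + 1 by exact: addr_ge0.
split=> //.
- by move=> x; split; [exact: Mp | exact: Np | exact: pK].
- move=> x Mx; apply: (@uniq _ (x - p x) _ 0) => //; last by rewrite addrC subrK addr0.
  by rewrite -(subrr (x - p x)); exact: NB.
- move=> x Nx; apply: (@uniq _ (x - p x) _ x) => //; last by rewrite addrC subrK add0r.
  by rewrite -(subrr (p x)); exact: MB.
- move=> x; split.
    by apply: le_trans (PC x) _; rewrite ler_wpM2r ?rnorm_ge0 // lerDl.
  apply: le_trans (rnormD _ _) _; rewrite rnormN mulrDl mul1r addrC.
  by rewrite lerD2r; exact: PC.
Qed.

(** * The adapted norm and the conclusion *)

Section AdaptedGauge.
Context (R : realType) (k : scalar_kind) (X : normedModType (scalar_field R k))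
  (n : nat) (A : {linear X -> X}).

(* The increasing weights n, ..., 2n - 1 turn |A^n x| <= |x| / 2 into a
   contraction by 1 - 1/(4n). *)
Definition adapted_gauge (x : X) : R :=
  \sum_(j < n) (n + j)%:R * rnorm (iter j A x).

Let iterB j x y : iter j A (x - y) = iter j A x - iter j A y.
Proof. by elim: j => //= j ->; rewrite linearB. Qed.

Let iter0 j : iter j A 0 = 0.
Proof. by rewrite -[X in iter j A X](subrr 0) iterB subrr. Qed.

Let iterN j x : iter j A (- x) = - iter j A x.
Proof. by rewrite -[X in iter j A X]sub0r iterB iter0 sub0r. Qed.

Let iterD j x y : iter j A (x + y) = iter j A x + iter j A y.
Proof. by rewrite -[in LHS](opprK y) iterB iterN opprK. Qed.

Lemma adapted_gauge_ge0 x : 0 <= adapted_gauge x.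
Proof. by apply: sumr_ge0 => j _; rewrite mulr_ge0 // rnorm_ge0. Qed.

Lemma adapted_gaugeD x y :
  adapted_gauge (x + y) <= adapted_gauge x + adapted_gauge y.
Proof.
rewrite /adapted_gauge -big_split; apply: ler_sum => j _.
by rewrite /= -mulrDr ler_wpM2l // iterD rnormD.
Qed.

Lemma adapted_gaugeN x : adapted_gauge (- x) = adapted_gauge x.
Proof. by apply: eq_bigr => j _; rewrite iterN rnormN. Qed.

Lemma adapted_gaugeMn x m : adapted_gauge (x *+ m) = adapted_gauge x *+ m.
Proof.
rewrite /adapted_gauge -sumrMnl; apply: eq_bigr => j _.
have -> : iter j A (x *+ m) = iter j A x *+ m.
  by elim: m => [|m IH]; rewrite ?mulr0n ?iter0 // !mulrS iterD IH.
by rewrite rnormMn mulrnAr.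
Qed.

Lemma adapted_gauge0 : adapted_gauge 0 = 0.
Proof. by rewrite /adapted_gauge big1 // => j _; rewrite iter0 rnorm0 mulr0. Qed.

Lemma rnorm_le_adapted_gauge x : (0 < n)%N -> rnorm x <= adapted_gauge x.
Proof.
move=> n0; rewrite /adapted_gauge (bigD1 (Ordinal n0)) //= addn0.
rewrite ler_wpDr ?sumr_ge0 // => [j _|]; first by rewrite mulr_ge0 // rnorm_ge0.
by rewrite ler_peMl ?rnorm_ge0 // ler1n.
Qed.

Lemma adapted_gauge_bounded (a : R) : 0 <= a ->
  (forall x, rnorm (A x) <= a * rnorm x) ->
  exists2 C : R, 0 <= C & forall x, adapted_gauge x <= C * rnorm x.
Proof.
move=> a0 Ha; exists (\sum_(j < n) (n + j)%:R * a ^+ j).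
  by apply: sumr_ge0 => j _; rewrite mulr_ge0 // exprn_ge0.
move=> x; rewrite mulr_suml; apply: ler_sum => j _.
rewrite -mulrA ler_wpM2l //; elim: (j : nat) => [|m IH]; first by rewrite mul1r.
rewrite /= exprS -mulrA; apply: le_trans (Ha _) _.
by rewrite ler_wpM2l.
Qed.

(** By Abel summation with r_n <= r_0/2, the gauge changes by at most r_0/2 minus the sum of the
    r_j, that is, it drops by at least half this sum. As the weights are below 2n, this is at least
    1/(4n) of the gauge. *)
Lemma adapted_gauge_contraction x : (0 < n)%N ->
  rnorm (iter n A x) <= 2^-1 * rnorm x ->
  adapted_gauge (A x) <= (1 - (4 * n%:R)^-1) * adapted_gauge x.
Proof.
move=> n0; pose r j := rnorm (iter j A x); rewrite -/(r n) => rn.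
have r0 j : 0 <= r j := rnorm_ge0 _.
have abel m : \sum_(j < m) (n + j)%:R * r j.+1 =
    \sum_(j < m) (n + j)%:R * r j - \sum_(j < m) r j
    - (n%:R - 1) * r 0%N + ((n + m)%:R - 1) * r m.
  elim: m => [|m IH]; first by rewrite !big_ord0 addn0; ring.
  by rewrite !big_ord_recr /= IH addnS -addn1 natrD; ring.
have -> : adapted_gauge (A x) = \sum_(j < n) (n + j)%:R * r j.+1.
  by apply: eq_bigr => j _; rewrite -iterSr.
rewrite abel -/(adapted_gauge x).
have n0R : 0 < n%:R :> R by rewrite ltr0n.
have H1 : r 0%N <= \sum_(j < n) r j.
  rewrite (bigD1 (Ordinal n0)) //= ler_wpDr // sumr_ge0 //.
have H2 : adapted_gauge x <= 2 * n%:R * \sum_(j < n) r j.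
  have -> : 2 * n%:R = (n + n)%:R :> R by rewrite natrD; ring.
  rewrite mulr_sumr; apply: ler_sum => j _; rewrite ler_wpM2r //; first exact: r0.
  by rewrite ler_nat leq_add2l ltnW.
have H3 : (4 * n%:R)^-1 * adapted_gauge x <= 2^-1 * \sum_(j < n) r j.
  rewrite mulrC ler_pdivrMr ?mulr_gt0 //; apply: le_trans H2 _.
  by rewrite le_eqVlt; apply/orP; left; apply/eqP; field.
have H4 : ((n + n)%:R - 1) * r n <= ((n + n)%:R - 1) * (2^-1 * r 0%N).
  by rewrite ler_wpM2l // subr_ge0 ler1n addn_gt0 n0.
rewrite mulrBl mul1r; move: H4; rewrite natrD => H4.
nra.
Qed.

End AdaptedGauge.

(** Moving [h 0] past the leftmost factor produces [T] and [h 1]; the induction goes on with the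
    shifted family. *)
Lemma comp_big_conjugacy (X : Type) (T : X -> X) p (f : 'I_p -> X -> X)
    (h : nat -> X -> X) :
  (forall (i : 'I_p) x, h i (f i x) = T (h i.+1 x)) ->
  forall x, h 0%N ((\big[comp/id]_(i < p) f i) x) = iter p T (h p x).
Proof.
elim: p f h => [|p IH] f h Hh x; first by rewrite big_ord0.
rewrite big_ord_recl /= (Hh ord0); congr T.
by rewrite (IH _ (fun n => h n.+1)) // => i y; exact: (Hh (lift ord0 i) y).
Qed.

Section Stability.
Context (R : realType) (k : scalar_kind)
  (X : completeNormedModType (scalar_field R k)).

Lemma sup_norm_lt (F : X -> X) (e : R) : (sup_norm F < e%:E)%E ->
  forall x, rnorm (F x) <= e.
Proof.
move=> Fe x; rewrite -lee_fin; apply: le_trans (ltW Fe).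
by apply: ereal_sup_ubound; exists x.
Qed.

Lemma Lip_lt (F : X -> X) (e : R) : (Lip F < e%:E)%E ->
  forall x y, rnorm (F x - F y) <= e * rnorm (x - y).
Proof.
move=> Fe x y; have [->|xy] := eqVneq x y; first by rewrite !subrr rnorm0 mulr0.
have : rnorm (F x - F y) / rnorm (x - y) <= e.
  rewrite -lee_fin; apply: le_trans (ltW Fe).
  by apply: ereal_sup_ubound; exists (x, y).
rewrite ler_pdivrMr // lt_neqAle rnorm_ge0 andbT eq_sym.
by apply: contra_neq xy => /rnorm_eq0/eqP; rewrite subr_eq0 => /eqP.
Qed.

Context (T S : {linear X -> X}) (M N : set X).

Lemma hyperbolic_renorming (n1 n2 : nat) :
  cancel T S -> cancel S T -> continuous T -> continuous S ->
  closed_subspace M -> closed_subspace N -> direct_sum M N ->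
  (forall x, M x -> M (T x)) -> (forall x, N x -> N (S x)) ->
  (0 < n1)%N -> (forall x, M x -> rnorm (iter n1 T x) <= 2^-1 * rnorm x) ->
  (0 < n2)%N -> (forall x, N x -> rnorm (iter n2 S x) <= 2^-1 * rnorm x) ->
  exists (mu : X -> R) (gmu : group_norm mu)
    (T' S' P Q : {additive renormed gmu -> renormed gmu}) (lam a b K : R),
  [/\ T' =1 T /\ S' =1 S, adapted_splitting T' S' P Q lam a b,
    geometrically_complete (renormed gmu), 0 <= b
    & 0 < K /\ forall x, rnorm x <= 2 * mu x /\ mu x <= K * rnorm x].
Proof.
move=> TK SK cT cS sM sN MN TM SN n10 HT n20 HS.
have [P [Q [C [C0 PQ PM PN PQC]]]] := direct_sum_projections sM sN MN.
have MP x : M (P x) by case: (PQ x).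
have NQ x : N (Q x) by case: (PQ x).
have {}PQ x : P x + Q x = x by case: (PQ x).
have QM x : M x -> Q x = 0.
  by move=> /PM Mx; have := PQ x; rewrite Mx -[RHS]addr0 => /addrI.
have QN x : N x -> Q x = x by move=> /PN Nx; have := PQ x; rewrite Nx add0r.
have [a a0 Ha] := continuous_linear_rnorm cT.
have [b b0 Hb] := continuous_linear_rnorm cS.
have [CT CT0 HCT] := adapted_gauge_bounded n1 a0 Ha.
have [CS CS0 HCS] := adapted_gauge_bounded n2 b0 Hb.
pose gT := adapted_gauge n1 T; pose gS := adapted_gauge n2 S.
(* A maximum, rather than a sum, is what gives [split_max]. *)
pose mu x := Num.max (gT (P x)) (gS (Q x)).
have gT0 x : 0 <= gT x := adapted_gauge_ge0 n1 T x.
have gS0 x : 0 <= gS x := adapted_gauge_ge0 n2 S x.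
have mu_ge0 x : 0 <= mu x by rewrite le_max gT0.
have low x : rnorm x <= 2 * mu x.
  rewrite -[in leLHS](PQ x); apply: le_trans (rnormD _ _) _.
  rewrite mulr2n mulrDl mul1r; apply: lerD.
    apply: le_trans (rnorm_le_adapted_gauge T (P x) n10) _.
    by rewrite le_max lexx.
  apply: le_trans (rnorm_le_adapted_gauge S (Q x) n20) _.
  by rewrite le_max lexx orbT.
pose K := (CT + CS) * C + 1.
have K0 : 0 < K by rewrite ltr_wpDl // mulr_ge0 // addr_ge0.
have upp x : mu x <= K * rnorm x.
  have [PC QC] := PQC x; have r0 := rnorm_ge0 x.
  have H1 : CT * rnorm (P x) <= CT * (C * rnorm x) by rewrite ler_wpM2l.
  have H2 : CS * rnorm (Q x) <= CS * (C * rnorm x) by rewrite ler_wpM2l.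
  have H3 : 0 <= CT * (C * rnorm x) by rewrite !mulr_ge0.
  have H4 : 0 <= CS * (C * rnorm x) by rewrite !mulr_ge0.
  rewrite ge_max /K; apply/andP; split.
    by apply: le_trans (HCT _) _; lra.
  by apply: le_trans (HCS _) _; lra.
have gmu : group_norm mu.
  split.
  - move=> x y; rewrite /mu ge_max !raddfD; apply/andP; split.
      by apply: le_trans (adapted_gaugeD _ _ _ _) _; rewrite lerD // le_max lexx.
    by apply: le_trans (adapted_gaugeD _ _ _ _) _; rewrite lerD // le_max lexx orbT.
  - move=> x x0; apply: (@rnorm_eq0 R k X); apply/le_anti; rewrite rnorm_ge0 andbT.
    by have := low x; rewrite x0 mulr0.
  - move=> x n; rewrite /mu (raddfMn P) (raddfMn Q).
    have -> : gT (P x *+ n) = gT (P x) *+ n by exact: adapted_gaugeMn.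
    have -> : gS (Q x *+ n) = gS (Q x) *+ n by exact: adapted_gaugeMn.
    by rewrite -[gT _ *+ n]mulr_natl -[gS _ *+ n]mulr_natl -[RHS]mulr_natl maxr_pMr.
  - move=> x; rewrite /mu (raddfN P) (raddfN Q).
    have -> : gT (- P x) = gT (P x) by exact: adapted_gaugeN.
    by have -> : gS (- Q x) = gS (Q x) by exact: adapted_gaugeN.
pose T' : {additive renormed gmu -> renormed gmu} := T.
pose S' : {additive renormed gmu -> renormed gmu} := S.
pose P' : {additive renormed gmu -> renormed gmu} := P.
pose Q' : {additive renormed gmu -> renormed gmu} := Q.
pose lq (n : nat) : R := 1 - (4 * n%:R)^-1; pose lT := lq n1; pose lS := lq n2.
have l01 n : (0 < n)%N -> 0 <= lq n < 1.
  move=> n0; have n1R : (1 : R) <= n%:R by rewrite ler1n.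
  have n4 : 0 < 4 * n%:R :> R by lra.
  have i0 : 0 < (4 * n%:R)^-1 :> R by rewrite invr_gt0.
  have i1 : (4 * n%:R)^-1 <= 1 :> R by rewrite invf_cp1 //; lra.
  by rewrite /lq; apply/andP; split; lra.
have /andP[lT0 lT1] : 0 <= lT < 1 by exact: l01.
have /andP[lS0 lS1] : 0 <= lS < 1 by exact: l01.
have muM x : M x -> mu x = gT x.
  move=> Mx; rewrite /mu PM // QM // /gS adapted_gauge0; apply/max_idPl; exact: gT0.
have muN x : N x -> mu x = gS x.
  move=> Nx; rewrite /mu PN // QN // /gT adapted_gauge0; apply/max_idPr; exact: gS0.
(* In the bounds for [T] and [S], the factors [K] and 2 pay for the passage from [mu] to [rnorm] and
   back. *)
exists mu, gmu, T', S', P', Q', (Num.max lT lS), (K * (a * 2)), (K * (b * 2)), K.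
split=> //; last by rewrite !mulr_ge0 // ltW.
- split=> //=.
  + by move=> x; apply: PM.
  + by move=> x; apply: PM; exact: TM.
  + by move=> x; apply: PN; exact: SN.
  + by rewrite le_max lT0 gt_max lT1.
  + by move=> x; rewrite !renormedE muM // le_max lexx.
  + move=> x; rewrite !renormedE muM; last exact: TM.
    apply: le_trans (adapted_gauge_contraction n10 (HT _ (MP x))) _.
    apply: le_trans (_ : lT * mu x <= _).
      by rewrite ler_wpM2l // le_max lexx.
    by rewrite ler_wpM2r // le_max lexx.
  + move=> x; rewrite !renormedE muN; last exact: SN.
    apply: le_trans (adapted_gauge_contraction n20 (HS _ (NQ x))) _.
    apply: le_trans (_ : lS * mu x <= _).
      by rewrite ler_wpM2l // le_max lexx orbT.
    by rewrite ler_wpM2r // le_max lexx orbT.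
  + by move=> x c; rewrite !renormedE muM // muN // ge_max => -> ->.
  + move=> x; rewrite !renormedE; apply: le_trans (upp _) _.
    rewrite -!mulrA ler_wpM2l ?(ltW K0) //; apply: le_trans (Ha _) _.
    by rewrite ler_wpM2l.
  + move=> x; rewrite !renormedE; apply: le_trans (upp _) _.
    rewrite -!mulrA ler_wpM2l ?(ltW K0) //; apply: le_trans (Hb _) _.
    by rewrite ler_wpM2l.
- apply: geometrically_complete_of_limit => u D q q01 uq.
  have [|l Hl] := @rnorm_complete R k X u (2 * D) q q01.
    move=> n; apply: le_trans (low _) _; rewrite -mulrA ler_wpM2l //; exact: uq.
  exists l, (K * (2 * D / (1 - q))) => n; rewrite renormedE.
  apply: le_trans (upp _) _; rewrite -mulrA ler_wpM2l ?(ltW K0) //.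
  by apply: le_trans (Hl n) _; rewrite mulrAC.
Qed.

End Stability.

Lemma renormed_continuous (R : realType) (k : scalar_kind)
    (X : completeNormedModType (scalar_field R k)) (mu : X -> R)
    (gmu : group_norm mu) (c K : R) (f : X -> X) : 0 < c -> 0 < K ->
  (forall x, rnorm x <= c * mu x) -> (forall x, mu x <= K * rnorm x) ->
  @metric_continuous R (renormed gmu) (renormed gmu) f -> continuous f.
Proof.
move=> c0 K0 low upp cf; apply/continuous_rnorm => x e e0.
have [d d0 Hd] := cf x _ (divr_gt0 e0 c0).
exists (d / K); first exact: divr_gt0.
move=> y; rewrite ltr_pdivlMr // mulrC => xy.
have /Hd : mu (x - y) < d by apply: le_lt_trans (upp _) xy.
rewrite renormedE ltr_pdivlMr // mulrC; apply: le_lt_trans; exact: low.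
Qed.

Theorem theorem1 (R : realType) (k : scalar_kind)
    (X : completeNormedModType (scalar_field R k)) (T : {linear X -> X}) :
  generalized_hyperbolic T -> time_dependent_stable T.
Proof.
move=> [S0 [[cT cS TS ST] [M [N [sM sN MN [TM specM] [SN specN]]]]]].
have linS : linear S0.
  by move=> c x y; rewrite -[RHS]TS linearP !ST.
pose S : {linear X -> X} := HB.pack S0 (GRing.isLinear.Build _ _ _ _ _ linS).
have {}TM x : M x -> M (T x) by move=> Mx; apply: TM; exists x.
have {}SN x : N x -> N (S x) by move=> Nx; apply: SN; exists x.
have [n1 n10 HT] := spectrum_restr_contraction sM cT TM specM.
have [n2 n20 HS] := @spectrum_restr_contraction R k X N S sN cS SN specN.
have [mu [gmu [T' [S' [P [Q [lam [a [b [K [[T'E S'E] spl cV b0 [K0 muE]]]]]]]]]]]] :=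
  @hyperbolic_renorming R k X T S M N n1 n2 TS ST cT cS sM sN MN TM SN n10 HT n20 HS.
have low x : rnorm x <= 2 * mu x := (muE x).1.
have upp x : mu x <= K * rnorm x := (muE x).2.
have /andP[lam0 lam1] := split_lam spl.
have b1 : 0 < b + 1 by rewrite ltr_wpDl.
(* The first term gives [lam + l < 1], for the conjugacies, the second [b * l < 1], for inverting T
   + L_j. *)
pose l := Num.min ((1 - lam) / 2) (2 * (b + 1))^-1.
have l0 : 0 < l by rewrite lt_min divr_gt0 ?subr_gt0 // invr_gt0 mulr_gt0.
have laml : lam + l < 1.
  have : l <= (1 - lam) / 2 by rewrite ge_min lexx.
  by lra.
have bl : b * l < 1.
  apply: le_lt_trans (_ : b * (2 * (b + 1))^-1 < 1).
    by rewrite ler_wpM2l // ge_min lexx orbT.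
  by rewrite ltr_pdivrMr ?mulr_gt0 // mul1r; lra.
(* Measured with [mu], Lipschitz constants grow by at most 2K, so that they stay below [l]. *)
exists (l / (2 * K)); first by rewrite divr_gt0 // mulr_gt0.
move=> [//|p] L _ HL.
have LB i (x : X) : mu (L i x) <= K * (l / (2 * K)).
  apply: le_trans (upp _) _; rewrite ler_wpM2l ?(ltW K0) //.
  by case: (HL i) => _ Hs _; exact: sup_norm_lt.
have Ll i (x y : X) : mu (L i x - L i y) <= l * mu (x - y).
  apply: le_trans (upp _) _.
  apply: le_trans (_ : K * (l / (2 * K) * (2 * mu (x - y))) <= _).
    rewrite ler_wpM2l ?(ltW K0) //; case: (HL i) => _ _ /Lip_lt Hl.
    apply: le_trans (Hl x y) _; rewrite ler_wpM2l // divr_ge0 ?(ltW l0) //.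
    by rewrite mulr_ge0 // ltW.
  by rewrite le_eqVlt; apply/orP; left; apply/eqP; field; rewrite gt_eqF.
(* Time is cyclic and runs downwards, since the factor of largest index acts first: the successor
   map is [ord_pred]. *)
have [h [h' [ch ch' hK h'K hT]]] := @nonautonomous_conjugacy R (renormed gmu)
  T' S' P Q lam a b spl cV 'I_p.+1 (@ord_pred _) (@ordS _) (@ord_predK _)
  (@ordSK _) L l _ (ltW l0) b0 laml bl Ll LB.
have cont (f : X -> X) : @metric_continuous R (renormed gmu) (renormed gmu) f ->
    continuous f by apply: renormed_continuous K0 low upp.
exists (h' ord_max), (h ord_max); split.
  by split; [exact: cont | exact: cont | exact: h'K | exact: hK].
apply: funext => x /=; apply: (can_inj (hK ord_max)); rewrite h'K.
(* The shift by one turns the predecessor relation into the one of [comp_big_conjugacy]; both ends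
   [H 0] and [H p.+1] are [h ord_max], which closes the cycle. *)
pose H n := if n is m.+1 then h (inord m) else h ord_max.
have := @comp_big_conjugacy X T p.+1 (fun i x => T x + L i x) H.
rewrite /H /= (_ : inord p = ord_max); last by apply: val_inj; rewrite /= inordK.
apply=> i y; rewrite inord_val -[T (h i y)]T'E -hT T'E.
case: i y => -[|m] mp y.
  by congr (h _ _); apply: val_inj; rewrite /= modn_small.
congr (h _ _); apply: val_inj.
by rewrite /= inordK ?(ltnW mp) // modnDr modn_small // ltnW.
Qed.
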